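(* Let $N\ge 2$ and $0<q<N/(N-1)$. There exists a constant $C>0$, depending only on $N$ and $q$, such that for every open set $\Omega\subseteq\mathbb{R}^N$ we have \[ \frac{1}{C}\,\big(h_q(\Omega)\big)^{\frac{2}{\frac{N}{q}-(N-1)}}\le \lambda(\Omega). \]
   Context: For an open set $\Omega\subseteq\mathbb{R}^N$ and $0<q<N/(N-1)$, the generalized Cheeger constant is \[ h_q(\Omega)=\inf\left\{\frac{\mathcal{H}^{N-1}(\partial E)}{|E|^{1/q}}\, :\, E\Subset\Omega \text{ non-empty open set with smooth boundary}\right\}, \] where $|\cdot|$ is the $N$-dimensional Lebesgue measure, $\mathcal{H}^{N-1}$ is the $(N-1)$-dimensional Hausdorff measure, and $E\Subset\Omega$ means that $\overline{E}$ is a compact subset of $\Omega$. The sharp Poincaré constant of $\Omega$ is \[ \lambda(\Omega)=\inf_{u\in C^\infty_0(\Omega)} \left\{\int_\Omega |\nabla u|^2\,dx\, :\, \int_\Omega |u|^2\,dx=1\right\}, \] where $C^\infty_0(\Omega)$ is the space of smooth functions with compact support in $\Omega$. *)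

(* Defs.v *)
(* Points of R^n are row vectors in ['rV[R]_n], for [R : realType]. *)
From HB Require Import structures.
From mathcomp Require Import all_boot all_order all_algebra.
From mathcomp Require Import all_classical all_reals all_analysis.
Set Implicit Arguments.
Unset Strict Implicit.
Unset Printing Implicit Defensive.
Import Order.TTheory GRing.Theory Num.Theory.
Import numFieldNormedType.Exports.
Local Open Scope classical_set_scope.
Local Open Scope ring_scope.

(** The sigma-algebra on ['rV[R]_n] is the product (coordinate) one, as in the
    library for tuples; by second countability it is the Borel sigma-algebra. *)
Section measurable_rV.
Context {R : realType} {n : nat}.

Definition rV_coord (i : 'I_n) (v : 'rV[R]_n) : measurableTypeR R := v ord0 i.

Let rV_set0 : g_sigma_preimage rV_coord set0.
Proof. exact: sigma_algebra0. Qed.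

Let rV_setC A : g_sigma_preimage rV_coord A -> g_sigma_preimage rV_coord (~` A).
Proof. exact: sigma_algebraC. Qed.

Let rV_bigcup (F : _^nat) : (forall i, g_sigma_preimage rV_coord (F i)) ->
  g_sigma_preimage rV_coord (\bigcup_i (F i)).
Proof. exact: sigma_algebra_bigcup. Qed.

HB.instance Definition _ := @isMeasurable.Build default_measure_display
  'rV[R]_n (g_sigma_preimage rV_coord) rV_set0 rV_setC rV_bigcup.

Lemma measurable_rV_coord (i : 'I_n) : measurable_fun setT (rV_coord i).
Proof.
move=> _ Y mY; rewrite setTI; apply: sub_sigma_algebra => /=.
rewrite -bigcup_seq/=; exists i => /=; first by rewrite mem_index_enum.
by exists Y => //; rewrite setTI.
Qed.

Lemma measurable_fun_rV d (T : measurableType d) (f : T -> 'rV[R]_n) :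
  (forall i, measurable_fun setT (rV_coord i \o f)) -> measurable_fun setT f.
Proof.
move=> mf _ A mA; rewrite setTI.
have : <<s \big[setU/set0]_(i < n)
    preimage_set_system setT (rV_coord i) measurable >> `<=`
    [set A | measurable (f @^-1` A)].
  apply: smallest_sub.
    split => [|B mB|F mF] /=.
    - by rewrite preimage_set0; exact: measurable0.
    - by rewrite setTD preimage_setC; exact: measurableC.
    - by rewrite preimage_bigcup; exact: bigcupT_measurable.
  move=> B; rewrite -bigcup_seq/= => -[i _ [C mC <-]] /=.
  by rewrite setTI -(setTI (f @^-1` _)); exact: mf.
exact.
Qed.

End measurable_rV.

(** Lebesgue measure on R^n: the n-fold product of the one-dimensional one. *)
Section lebesgue_rV.
Context {R : realType}.

Section step.
Variables (n : nat) (mu : {sigma_finite_measure set 'rV[R]_n -> \bar R}).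

Definition consrV (p : measurableTypeR R * 'rV[R]_n) : 'rV[R]_n.+1 :=
  row_mx (p.1)%:M p.2 : 'rV[R]_(1 + n).

Definition unconsrV (v : 'rV[R]_n.+1) : measurableTypeR R * 'rV[R]_n :=
  (v ord0 ord0, rsubmx (v : 'rV[R]_(1 + n))).

Lemma consrVK : cancel consrV unconsrV.
Proof.
case=> x v; rewrite /unconsrV /consrV row_mxKr; congr pair.
rewrite -[RHS](_ : row_mx (x%:M : 'M[R]_1) v ord0 (lshift n ord0) = x).
  by congr (row_mx _ _ _ _); exact: val_inj.
by rewrite row_mxEl mxE eqxx.
Qed.

Lemma measurable_consrV : measurable_fun setT consrV.
Proof.
apply: measurable_fun_rV => i.
case: (split_ordP (i : 'I_(1 + n))) => j ->.
- rewrite (_ : _ \o _ = fst); first exact: measurable_fst.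
  apply/funext => p; apply: etrans (row_mxEl _ _ _ _) _.
  by rewrite !ord1 mxE eqxx.
- rewrite (_ : _ \o _ = rV_coord j \o snd).
    by apply: measurableT_comp; [exact: measurable_rV_coord|exact: measurable_snd].
  by apply/funext => p; exact: row_mxEr.
Qed.

Lemma measurable_unconsrV : measurable_fun setT unconsrV.
Proof.
apply: measurable_fun_pair; first exact: (measurable_rV_coord ord0).
apply: measurable_fun_rV => i.
rewrite (_ : _ \o _ = rV_coord (rshift 1 i : 'I_n.+1)).
  exact: measurable_rV_coord.
by apply/funext => v; rewrite /= /rV_coord mxE.
Qed.

Definition lebesgue_cons : set 'rV[R]_n.+1 -> \bar R :=
  pushforward (lebesgue_measure \x mu)%E consrV.

Let lebesgue_cons0 : lebesgue_cons set0 = 0%E.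
Proof. by rewrite /lebesgue_cons /pushforward preimage_set0 measure0. Qed.

Let lebesgue_cons_ge0 A : (0 <= lebesgue_cons A)%E.
Proof. by rewrite /lebesgue_cons /pushforward measure_ge0. Qed.

Let lebesgue_cons_sigma_additive : semi_sigma_additive lebesgue_cons.
Proof.
have mcons A : measurable A -> measurable (consrV @^-1` A).
  by move=> mA; rewrite -(setTI (_ @^-1` _)); exact: measurable_consrV.
move=> F mF tF mUF; rewrite /lebesgue_cons /pushforward preimage_bigcup.
apply: measure_semi_sigma_additive => [k||]; first exact: mcons.
- apply/trivIsetP => /= i j _ _ ij; rewrite -preimage_setI.
  by move/trivIsetP : tF => /(_ _ _ _ _ ij) ->//; rewrite preimage_set0.
- by rewrite -preimage_bigcup; exact: mcons.
Qed.

HB.instance Definition _ := isMeasure.Build _ _ _ lebesgue_cons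
  lebesgue_cons0 lebesgue_cons_ge0 lebesgue_cons_sigma_additive.

Let lebesgue_cons_sigma_finite : sigma_finite setT lebesgue_cons.
Proof.
have /sigma_finiteP[F [UF ndF Foo]] := sigma_finiteT (@lebesgue_measure R).
have /sigma_finiteP[G [UG ndG Goo]] := sigma_finiteT mu.
exists (fun i => unconsrV @^-1` (F i `*` G i)).
  apply/esym; rewrite -preimage_bigcup -subTset => v _.
  have [i _ Fi] : (\bigcup_i F i) (unconsrV v).1 by rewrite -UF.
  have [j _ Gj] : (\bigcup_i G i) (unconsrV v).2 by rewrite -UG.
  exists (maxn i j) => //; split.
  - by move: Fi; exact/subsetPset/ndF/leq_maxl.
  - by move: Gj; exact/subsetPset/ndG/leq_maxr.
move=> i; have [mF Fioo] := Foo i; have [mG Gioo] := Goo i; split.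
  by rewrite -(setTI (_ @^-1` _)); exact: measurable_unconsrV (measurableX _ _).
rewrite /lebesgue_cons /pushforward -comp_preimage.
rewrite (_ : _ \o _ = id) ?preimage_id; last exact/funext/consrVK.
by rewrite product_measure1E// lte_mul_pinfty// ge0_fin_numE.
Qed.

HB.instance Definition _ := @Measure_isSigmaFinite.Build _ _ _ lebesgue_cons
  lebesgue_cons_sigma_finite.

End step.

Fixpoint lebesgue_rV (n : nat) :
    {sigma_finite_measure set 'rV[R]_n -> \bar R} :=
  match n with
  | 0 => \d_(0 : 'rV[R]_0)
  | m.+1 => lebesgue_cons (lebesgue_rV m)
  end.

End lebesgue_rV.
Arguments lebesgue_rV {R} n.

Section definitions.
Context {R : realType}.

(** The norm [`|v|] of the library is the sup norm on ['rV[R]_n]; it induces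
    the usual topology, but lengths and diameters are Euclidean. *)
Definition enorm n (v : 'rV[R]_n) : R := Num.sqrt (\sum_(i < n) v ord0 i ^+ 2).

Definition pderiv n (i : 'I_n) (f : 'rV[R]_n -> R) : 'rV[R]_n -> R :=
  fun x => 'D_(delta_mx ord0 i) f x.

Definition grad n (f : 'rV[R]_n -> R) (x : 'rV[R]_n) : 'rV[R]_n :=
  \row_(i < n) pderiv i f x.

(** C^oo on the open set [U]: the partial derivatives of all orders, in any
    order of differentiation [s], exist and are continuous on [U]. *)
Definition smooth_on n (U : set 'rV[R]_n) (f : 'rV[R]_n -> R) : Prop :=
  forall (s : seq 'I_n) (x : 'rV[R]_n), U x ->
    {for x, continuous (foldr (@pderiv n) f s)} /\
    forall i : 'I_n, derivable (foldr (@pderiv n) f s) x (delta_mx ord0 i).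

(** [C_0^oo(Omega)], its elements being extended by 0 outside [Omega]. *)
Definition test_function n (Omega : set 'rV[R]_n) (u : 'rV[R]_n -> R) : Prop :=
  [/\ smooth_on setT u, compact (closure [set x | u x != 0]) &
      closure [set x | u x != 0] `<=` Omega].

Definition poincare_constant n (Omega : set 'rV[R]_n) : \bar R :=
  ereal_inf
    [set (\int[lebesgue_rV n]_(x in Omega) (enorm (grad u x) ^+ 2)%:E)%E
    | u in [set u | test_function Omega u /\
        (\int[lebesgue_rV n]_(x in Omega) (`|u x| ^+ 2)%:E = 1)%E]].

Definition diameter n (A : set 'rV[R]_n) : \bar R :=
  ereal_sup [set (enorm (p.1 - p.2))%:E | p in A `*` A].

(** Summand of the [k]-dimensional Hausdorff measure: the volume of the
    [k]-dimensional ball with the diameter of [A] (so that the Hausdorff measure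
    of dimension [n] on R^n is Lebesgue measure). The case distinction is needed
    because [diameter set0 = -oo]. *)
Definition hausdorff_gauge n (k : nat) (A : set 'rV[R]_n) : \bar R :=
  if A == set0 then 0%E
  else (lebesgue_rV k [set v | (enorm v < 1)%R] *
        ((2^-1)%:E * diameter A) ^+ k)%E.

Definition hausdorff_premeasure n (k : nat) (delta : R) (A : set 'rV[R]_n) :
    \bar R :=
  ereal_inf [set (\sum_(0 <= i <oo) hausdorff_gauge k (F i))%E
    | F in [set F : (set 'rV[R]_n)^nat | A `<=` \bigcup_i F i /\
        forall i, (diameter (F i) <= delta%:E)%E]].

Definition hausdorff_measure n (k : nat) (A : set 'rV[R]_n) : \bar R :=
  ereal_sup [set hausdorff_premeasure k delta A | delta in [set d : R | 0 < d]].

Definition boundary n (A : set 'rV[R]_n) : set 'rV[R]_n :=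
  closure A `\` interior A.

(** Near each boundary point, [E] is a strict sublevel set of a smooth function
    without critical points. *)
Definition smooth_boundary n (E : set 'rV[R]_n) : Prop :=
  forall x, boundary E x ->
    exists (U : set 'rV[R]_n) (phi : 'rV[R]_n -> R),
      [/\ open U, U x, smooth_on U phi, (forall y, U y -> grad phi y != 0) &
          E `&` U = [set y | phi y < 0] `&` U].

Definition compactly_contained n (E Omega : set 'rV[R]_n) : Prop :=
  compact (closure E) /\ closure E `<=` Omega.

Definition cheeger_constant n (q : R) (Omega : set 'rV[R]_n) : \bar R :=
  ereal_inf
    [set (hausdorff_measure n.-1 (boundary E) / lebesgue_rV n E `^ q^-1)%E
    | E in [set E | [/\ E !=set0, open E, smooth_boundary E &
                        compactly_contained E Omega]]].

End definitions.

(* Main.v *)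
(** Let [u] be a test function with [int u^2 = 1] and [int |grad u|^2 <= A^2],
    and let [v = u^2], so that [int |grad v| <= c A int v]. It suffices to find
    an admissible [E] with [H(boundary E) <= c A |E|] whose measure compares
    with [A^-N]: at most for [q >= 1], at least for [q < 1]. Then
    [H(boundary E) / |E|^(1/q) <= c A |E|^(1 - 1/q) <= c' A^(N/q - (N - 1))].

    [E] is a superlevel set of [w - a.x], where [w] is a modification of [v] and
    [a] is a tiny vector. Covering the level sets by the cubes of a fine grid
    gives [int H(w = t) dt <= c int |grad w|], hence a good level [t]. The tilt [a]
    makes almost every level regular for a trivial reason: the bad pairs [(a, t)]
    form the image of a smooth map from R^N to R^(N+1).

    For [q >= 1], [w] is [v] cut off by a paraboloid to a ball of radius [1/A],
    whose centre is chosen by averaging. For [q < 1], [w = v] and only the levels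
    [t] with [|{v > t}| >= c A^-N] are used: by a Poincare inequality for functions
    with small support, they carry half of the mass of [v]. *)
Require Import Defs.
From HB Require Import structures.
From mathcomp Require Import all_boot all_order all_algebra.
From mathcomp Require Import all_classical all_reals all_analysis.
From mathcomp Require Import measurable_realfun ring lra.
Set Implicit Arguments.
Unset Strict Implicit.
Unset Printing Implicit Defensive.
Import Order.TTheory GRing.Theory Num.Theory.
Import numFieldNormedType.Exports.
Local Open Scope classical_set_scope.
Local Open Scope ring_scope.

(** * Lebesgue measure on R^n *)

Section Rn_measure.
Context {R : realType}.
Implicit Types (n : nat).

(** The exponents are forced by scaling: a dilation by [s] divides [A] by [s] and multiplies
    [H(boundary E) / |E|^(1/q)] by [s^(N - 1 - N/q)].

    Level sets only yield a bound of [H(boundary E)] by [A |E|]. Passing to [|E|^(1/q)] costs the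
    factor [|E|^(1 - 1/q)], whose exponent changes sign at [q = 1]. No single construction serves
    both signs: a superlevel set of [v] itself can be very large, and one of a localized function
    very small.

    Only upper bounds for the Hausdorff measure are needed, so one half of the coarea formula
    suffices, and constants may be lost freely: cubes replace balls and the l^1 norm of the gradient
    replaces the Euclidean one. The cutoff can be a polynomial, because it is used only where it is
    positive; its zeros on the sphere keep the superlevel sets compactly inside the ball.

    The selection of a level starts from a strict inequality. Its room absorbs the tilt and a set of
    bad levels of small positive measure, so that no null sets and no limit in the tilt are
    required. *)

Lemma consrV_ord0 n (p : measurableTypeR R * 'rV[R]_n) :
  consrV p ord0 ord0 = p.1.
Proof.
rewrite /consrV (_ : ord0 = lshift n (ord0 : 'I_1) :> 'I_(1 + n)); last exact: val_inj.
by apply: etrans (row_mxEl _ _ _ _) _; rewrite mxE eqxx.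
Qed.

Lemma consrV_lift n (p : measurableTypeR R * 'rV[R]_n) (i : 'I_n) :
  consrV p ord0 (lift ord0 i) = p.2 ord0 i.
Proof.
rewrite /consrV (_ : lift ord0 i = rshift 1 i :> 'I_(1 + n)); last exact: val_inj.
exact: row_mxEr.
Qed.

(** Half-open, so that the cubes of a grid are pairwise disjoint and still cover. *)
Definition cube n (a : 'rV[R]_n) (s : R) : set 'rV[R]_n :=
  [set x | forall i, a ord0 i <= x ord0 i < a ord0 i + s].

Lemma measurable_cube n (a : 'rV[R]_n) s : measurable (cube a s).
Proof.
rewrite (_ : cube a s = \bigcap_(i : 'I_n)
    (rV_coord i @^-1` `[a ord0 i, a ord0 i + s[%classic)); last first.
  by apply/seteqP; split=> [x ax i _|x ax i]; have := ax i;
     rewrite /= in_itv /=; [apply|apply].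
apply: fin_bigcap_measurable => [|i _]; first exact: finite_finset.
by rewrite -[X in measurable X]setTI; apply: measurable_rV_coord.
Qed.

Lemma lebesgue_rVS n : @lebesgue_rV R n.+1 =
  pushforward (lebesgue_measure \x lebesgue_rV n)%E (@consrV R n)
    :> (set _ -> \bar R).
Proof. by []. Qed.

Lemma lebesgue_cube n (a : 'rV[R]_n) s : 0 <= s ->
  lebesgue_rV n (cube a s) = (s ^+ n)%:E.
Proof.
move=> s0; elim: n a => [|n IH] a.
  rewrite expr0 /= diracE mem_set//; by case.
rewrite lebesgue_rVS /pushforward.
rewrite (_ : _ @^-1` _ = `[a ord0 ord0, a ord0 ord0 + s[%classic `*`
    cube (\row_i a ord0 (lift ord0 i)) s); last first.
  apply/seteqP; split=> [[x v] /= axv|[x v] /= [ax av] i].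
    split=> /=; first by have := axv ord0; rewrite consrV_ord0 in_itv.
    by move=> i; have := axv (lift ord0 i); rewrite consrV_lift mxE.
  case: (unliftP ord0 i) => [j ->|->].
    by have := av j; rewrite mxE consrV_lift.
  by rewrite consrV_ord0; move: ax; rewrite in_itv.
rewrite product_measure1E//; last exact: measurable_cube.
rewrite IH [X in (X * _)%E]lebesgue_measure_itv/= lte_fin.
have [s_gt0|s_le0] := ltP 0 s.
  by rewrite ltrDl s_gt0 -EFinB addrAC subrr add0r -EFinM exprS.
have -> : s = 0 by apply/eqP; rewrite eq_le s0 s_le0.
by rewrite addr0 ltxx mul0e expr0n.
Qed.

Lemma ball_rVP n (x y : 'rV[R]_n) e :
  ball x e y <-> 0 < e /\ forall i, `|x ord0 i - y ord0 i| < e.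
Proof.
split=> [[e0 xy]|[e0 xy]]; split=> //.
  by move=> i; exact: xy.
by move=> j i; rewrite (ord1 j); exact: xy.
Qed.

Lemma nbhs_rVP n (x : 'rV[R]_n) (A : set 'rV[R]_n) :
  nbhs x A <-> exists2 e : R, 0 < e &
    forall y : 'rV[R]_n, (forall i, `|x ord0 i - y ord0 i| < e) -> A y.
Proof.
rewrite -nbhs_ballE; split=> [[e /= e0 xA]|[e e0 xA]].
  by exists e => // y xy; apply: xA; apply/ball_rVP.
by exists e => //= y /ball_rVP[_]; exact: xA.
Qed.

(** Second countability at work: an open set is the countable union of the cubes with rational
    corner and side [1 / k.+1] that it contains, and these belong to the coordinate
    sigma-algebra. *)
Lemma open_measurable_rV n (U : set 'rV[R]_n) : open U -> measurable U.
Proof.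
move=> oU.
pose c (p : 'rV[rat]_n * nat) : set 'rV[R]_n :=
  cube (map_mx ratr p.1) (p.2.+1%:R^-1).
rewrite (_ : U = \bigcup_(p in [set p | c p `<=` U]) c p); last first.
  apply/seteqP; split=> [x Ux|x [p /=]]; last exact.
  move: oU => /(_ x Ux)/nbhs_rVP[e e0 eU].
  have [k ke] : exists k : nat, k.+1%:R^-1 < e.
    have := @near_infty_natSinv_lt R (PosNum e0); case=> k _  /(_ k (leqnn k)) /= ?.
    by exists k.
  have k0 : 0 < k.+1%:R^-1 :> R by rewrite invr_gt0.
  have q_ i : {q : rat | x ord0 i - k.+1%:R^-1 < ratr q < x ord0 i}.
    apply/cid; have /rat_in_itvoo[q] : x ord0 i - k.+1%:R^-1 < x ord0 i.
      by rewrite ltrBlDr ltrDl.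
    by rewrite inE; exists q.
  exists (\row_i sval (q_ i), k) => /=.
    move=> y cy; apply: eU => i; have := cy i; rewrite !mxE.
    move: (k.+1%:R^-1) (x ord0 i) (y ord0 i) (q_ i) k0 ke => d a b q_i d0 de.
    case: q_i => q /= /andP[h1 h2] /andP[h3 h4].
    by rewrite ltr_norml; apply/andP; split; lra.
  move=> i; rewrite !mxE.
  move: (k.+1%:R^-1) (x ord0 i) (q_ i) => d a q_i.
  by case: q_i => q /= /andP[h1 h2]; apply/andP; split; lra.
rewrite bigcup_mkcond; apply: countable_bigcupT_measurable => [|p].
  exact: countableP.
by case: ifP => // _; exact: measurable_cube.
Qed.

Lemma continuous_measurable_rV n (f : 'rV[R]_n -> R) :
  continuous f -> measurable_fun setT f.
Proof.
move=> cf; apply: (measurability _ (measurable_realfun.RGenOpens.measurableE R)).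
move=> _ [_ [a [b ->]] <-]; rewrite setTI.
apply: open_measurable_rV; apply: open_comp; last exact: interval_open.
by move=> x _; exact: cf.
Qed.

Lemma measurable_shiftR (y : R) :
  measurable_fun setT (fun x : measurableTypeR R => x + y : measurableTypeR R).
Proof.
have h := @measurable_funD _ (measurableTypeR R) R setT idfun (cst y).
apply: h; first exact: measurable_id.
exact: measurable_cst.
Qed.

Lemma lebesgue_measure_shift (y : R) (A : set R) : measurable A ->
  lebesgue_measure ((fun x => x + y) @^-1` A) = lebesgue_measure A.
Proof.
move=> mA; apply/esym.
rewrite -[RHS]/(pushforward lebesgue_measure
  (fun x : measurableTypeR R => x + y : measurableTypeR R) A).
apply: lebesgue_measure_unique => //=; first exact: measurable_shiftR.
move=> _ _ [[a b]] _ <-; rewrite /pushforward.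
rewrite (_ : _ @^-1` _ = `]a - y, b - y]%classic); last first.
  by apply/seteqP; split=> x /=; rewrite !in_itv/= ltrBlDr lerBrDr.
rewrite !lebesgue_measure_itv/= !lte_fin ltrD2r.
by case: ifP => // _; rewrite -!EFinB; congr EFin; lra.
Qed.

Lemma measurable_shift_rV n (y : 'rV[R]_n) :
  measurable_fun setT (fun x : 'rV[R]_n => x + y).
Proof.
apply: measurable_fun_rV => i.
rewrite (_ : _ \o _ = fun x => rV_coord i x + y ord0 i); last first.
  by apply/funext => x; rewrite /= /rV_coord mxE.
by apply: measurable_funD => //; exact: measurable_rV_coord.
Qed.

(** By induction on the dimension: the translated measure agrees with the product measure on
    rectangles, and a product measure is determined by these. *)
Lemma lebesgue_rV_shift n (y : 'rV[R]_n) (A : set 'rV[R]_n) : measurable A ->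
  lebesgue_rV n ((fun x => x + y) @^-1` A) = lebesgue_rV n A.
Proof.
elim: n y A => [|n IH] y A mA.
  congr (lebesgue_rV 0 _); apply/seteqP.
  by split=> x /=; rewrite [_ + _](_ : _ = x)//; apply/rowP => -[].
rewrite lebesgue_rVS /pushforward.
pose S (p : measurableTypeR R * 'rV[R]_n) : measurableTypeR R * 'rV[R]_n :=
  (p.1 + y ord0 ord0, p.2 + \row_i y ord0 (lift ord0 i)).
have mS : measurable_fun setT S.
  apply: measurable_fun_pair => /=.
    by apply: (measurableT_comp (measurable_shiftR _)); exact: measurable_fst.
  by apply: (measurableT_comp (measurable_shift_rV _)); exact: measurable_snd.
have SE p : consrV p + y = consrV (S p).
  apply/rowP => i; rewrite mxE; case: (unliftP ord0 i) => [j ->|->].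
    by rewrite !consrV_lift /= !mxE.
  by rewrite !consrV_ord0.
rewrite (_ : _ @^-1` (_ @^-1` A) = S @^-1` (consrV (n:=n) @^-1` A)); last first.
  by apply/seteqP; split=> p; rewrite /preimage /= SE.
apply/esym; rewrite -[RHS]/(pushforward (lebesgue_measure \x lebesgue_rV n)%E S _).
apply: product_measure_unique; last 2 first.
- move=> B C mB mC.
  rewrite -[LHS]/((lebesgue_measure \x lebesgue_rV n)%E (S @^-1` (B `*` C))).
  rewrite (_ : S @^-1` _ = ((fun x => x + y ord0 ord0) @^-1` B) `*`
     ((fun x => x + \row_i y ord0 (lift ord0 i)) @^-1` C))//.
  rewrite product_measure1E; last 2 first.
    by rewrite -[X in measurable X]setTI; apply: measurable_shiftR.
    by rewrite -[X in measurable X]setTI; apply: measurable_shift_rV.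
  by rewrite IH//; congr (_ * _)%E; exact: lebesgue_measure_shift.
- by rewrite -[X in measurable X]setTI; apply: measurable_consrV.
Qed.

Lemma integral_shift_rV n (y : 'rV[R]_n) (f : 'rV[R]_n -> \bar R) :
  measurable_fun setT f -> (forall x, 0 <= f x)%E ->
  (\int[lebesgue_rV n]_x f (x + y)%R = \int[lebesgue_rV n]_x f x)%E.
Proof.
move=> mf f0; have ms := measurable_shift_rV y.
rewrite -(@ge0_integral_pushforward _ _ _ _ _ _ ms (lebesgue_rV n) setT f)//.
by apply: eq_measure_integral => //= A mA _; exact: lebesgue_rV_shift.
Qed.

End Rn_measure.

(** * Calculus of smooth functions *)

Section smooth_functions.
Context {R : realType} {n : nat}.
Implicit Types (f g : 'rV[R]_n -> R) (x y : 'rV[R]_n) (i : 'I_n).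

Lemma smooth_continuous f : smooth_on setT f -> continuous f.
Proof. by move=> sf x; have [] := sf [::] x Logic.I. Qed.

Lemma smooth_derivable f x i :
  smooth_on setT f -> derivable f x (delta_mx ord0 i).
Proof. by move=> sf; have [_] := sf [::] x Logic.I. Qed.

Lemma smooth_pderiv f i : smooth_on setT f -> smooth_on setT (pderiv i f).
Proof. by move=> sf s x _; have := sf (rcons s i) x Logic.I; rewrite foldr_rcons. Qed.

Lemma smooth_onW (U : set 'rV[R]_n) f : smooth_on setT f -> smooth_on U f.
Proof. by move=> sf s x _; exact: sf. Qed.

Lemma pderivD f g i : smooth_on setT f -> smooth_on setT g ->
  pderiv i (f \+ g) = pderiv i f \+ pderiv i g.
Proof.
move=> sf sg; apply/funext => x.
by rewrite /pderiv -[_ \+ _]/(f + g) deriveD//; exact: smooth_derivable.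
Qed.

Lemma pderivM f g i : smooth_on setT f -> smooth_on setT g ->
  pderiv i (f \* g) = (f \* pderiv i g) \+ (g \* pderiv i f).
Proof.
move=> sf sg; apply/funext => x.
by rewrite /pderiv -[_ \* _]/(f * g) deriveM//; exact: smooth_derivable.
Qed.

(* Membership in this algebra, unlike smoothness itself, is visibly stable
   under [pderiv]; this gives the smoothness of sums and products. *)
Inductive smooth_alg : ('rV[R]_n -> R) -> Prop :=
| smooth_alg_base f of smooth_on setT f : smooth_alg f
| smooth_alg_add f g of smooth_alg f & smooth_alg g : smooth_alg (f \+ g)
| smooth_alg_mul f g of smooth_alg f & smooth_alg g : smooth_alg (f \* g).

Lemma smooth_alg_derivable f x i :
  smooth_alg f -> derivable f x (delta_mx ord0 i).
Proof.
elim=> [{}f /smooth_derivable//|{}f g _ df _ dg|{}f g _ df _ dg].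
  exact: derivableD.
exact: derivableM.
Qed.

Lemma smooth_alg_continuous f : smooth_alg f -> continuous f.
Proof.
elim=> [{}f /smooth_continuous//|{}f g _ df _ dg|{}f g _ df _ dg] x.
  exact: cvgD (df x) (dg x).
exact: cvgM (df x) (dg x).
Qed.

Lemma smooth_alg_pderiv f i : smooth_alg f -> smooth_alg (pderiv i f).
Proof.
elim=> [{}f /smooth_pderiv sf|{}f g af df ag dg|{}f g af df ag dg].
- exact/smooth_alg_base/sf.
- rewrite (_ : pderiv i _ = pderiv i f \+ pderiv i g).
    exact: smooth_alg_add.
  apply/funext => x; rewrite /pderiv -[_ \+ _]/(f + g).
  by rewrite deriveD//; exact: smooth_alg_derivable.
- rewrite (_ : pderiv i _ = (f \* pderiv i g) \+ (g \* pderiv i f)).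
    by apply: smooth_alg_add; exact: smooth_alg_mul.
  apply/funext => x; rewrite /pderiv -[_ \* _]/(f * g).
  by rewrite deriveM//; exact: smooth_alg_derivable.
Qed.

Lemma smooth_alg_smooth f : smooth_alg f -> smooth_on setT f.
Proof.
move=> af s x _; have : smooth_alg (foldr (@pderiv R n) f s).
  by elim: s => // i s; exact: smooth_alg_pderiv.
move=> afs; split; first exact: smooth_alg_continuous.
by move=> i; exact: smooth_alg_derivable.
Qed.

Lemma smoothD f g : smooth_on setT f -> smooth_on setT g ->
  smooth_on setT (f \+ g).
Proof.
by move=> sf sg; apply/smooth_alg_smooth/smooth_alg_add; exact/smooth_alg_base.
Qed.

Lemma smoothM f g : smooth_on setT f -> smooth_on setT g ->
  smooth_on setT (f \* g).
Proof.
by move=> sf sg; apply/smooth_alg_smooth/smooth_alg_mul; exact/smooth_alg_base.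
Qed.

Lemma pderiv_cst i (c : R) : pderiv i (cst c) = cst 0.
Proof. by apply/funext => x; rewrite /pderiv derive_cst. Qed.

Lemma smooth_cst (c : R) : smooth_on setT (cst c : 'rV[R]_n -> R).
Proof.
move=> s x _.
have [d E] : exists d : R, foldr (@pderiv R n) (cst c : 'rV[R]_n -> R) s = cst d.
  elim: s => [|i s [d E]]; first by exists c.
  by exists 0; rewrite /= E pderiv_cst.
split; first by rewrite [foldr _ _ _]E; exact: cst_continuous.
by move=> i; rewrite [foldr _ _ _]E; exact: derivable_cst.
Qed.

Lemma is_derive_coord (j : 'I_n) x i :
  is_derive x (delta_mx ord0 i) (fun y : 'rV[R]_n => y ord0 j) (i == j)%:R.
Proof.
have h : (fun h : R => h^-1 *: (((fun y : 'rV[R]_n => y ord0 j) \o shift x)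
    (h *: delta_mx ord0 i) - x ord0 j)) @ (0 : R)^' --> ((i == j)%:R : R).
  apply: cvg_near_cst; near=> h => /=.
  rewrite !mxE eqxx /= eq_sym addrK /GRing.scale /= mulrA mulVf ?mul1r//.
  by near: h; exact: nbhs_dnbhs_neq.
by apply: DeriveDef; [apply/cvg_ex; exists (i == j)%:R|exact: cvg_lim h].
Unshelve. all: by end_near. Qed.

Lemma pderiv_coord i (j : 'I_n) :
  pderiv i (fun y : 'rV[R]_n => y ord0 j) = cst (i == j)%:R.
Proof.
by apply/funext => x; rewrite /pderiv (@derive_val _ _ _ _ _ _ _ (is_derive_coord j x i)).
Qed.

Lemma smooth_coord (j : 'I_n) : smooth_on setT (fun y : 'rV[R]_n => y ord0 j).
Proof.
(* [foldr] applies the last index first, so the list is split at its end, where the derivative of a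
   coordinate is already a constant. *)
move=> s; case/lastP: s => [|s i] x _ /=.
  split; first exact: coord_continuous.
  by move=> i; have [] := is_derive_coord j x i.
by rewrite foldr_rcons pderiv_coord; exact: (smooth_cst _ s Logic.I).
Qed.

Lemma is_derive_line f x i (s : R) : smooth_on setT f ->
  is_derive s 1 (fun s : R => f (x + s *: delta_mx ord0 i))
    (pderiv i f (x + s *: delta_mx ord0 i)).
Proof.
move=> sf; have [] := derivableP (@smooth_derivable _ (x + s *: delta_mx ord0 i) i sf).
rewrite /derivable /derive /pderiv => df _.
have E : (fun h : R => h^-1 *: (((fun s0 : R => f (x + s0 *: delta_mx ord0 i)) \o shift s)
    (h *: (1 : R)) - f (x + s *: delta_mx ord0 i))) =
  (fun h : R => h^-1 *: ((f \o shift (x + s *: delta_mx ord0 i))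
    (h *: delta_mx ord0 i) - f (x + s *: delta_mx ord0 i))).
  apply/funext => h /=; congr (_ *: (f _ - _)).
  by rewrite [h *: 1]mulr1 scalerDl addrCA.
by split; rewrite /derivable /derive E.
Qed.

End smooth_functions.

(** * Increments controlled by partial derivatives *)

Section increments.
Context {R : realType} {n : nat}.
Implicit Types (f g : 'rV[R]_n -> R) (x y : 'rV[R]_n) (i : 'I_n).

Lemma smooth_line_MVT f x i (h : R) : smooth_on setT f ->
  exists2 t, Num.min 0 h <= t <= Num.max 0 h &
    f (x + h *: delta_mx ord0 i) - f x
      = pderiv i f (x + t *: delta_mx ord0 i) * h.
Proof.
move=> sf; pose g s := f (x + s *: delta_mx ord0 i).
have dg (s : R) : is_derive s 1 g (pderiv i f (x + s *: delta_mx ord0 i)).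
  exact: is_derive_line.
have cg (a b : R) : {within `[a, b], continuous g}.
  apply: continuous_subspaceT => s.
  apply: differentiable_continuous; apply/derivable1_diffP.
  by have [] := dg s.
have g0 : g 0 = f x by rewrite /g scale0r addr0.
have [h0|h0] := leP 0 h.
  have [t] := MVT_segment h0 (fun s _ => dg s) (cg 0 h).
  rewrite in_itv /= => th; rewrite g0 subr0 => E.
  by exists t.
have [t] := MVT_segment (ltW h0) (fun s _ => dg s) (cg h 0).
rewrite in_itv /= => th; rewrite g0 sub0r mulrN => /eqP.
rewrite -eqr_oppLR opprB => /eqP E.
by exists t.
Qed.

(* The segment from [x] to [y] is replaced by the path that changes one
   coordinate at a time, as only partial derivatives are available. *)
Lemma coord_increments f (M : 'I_n -> R) x y : smooth_on setT f ->
  (forall i (z : 'rV[R]_n), (forall j, Num.min (x ord0 j) (y ord0 j) <=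
      z ord0 j <= Num.max (x ord0 j) (y ord0 j)) -> `|pderiv i f z| <= M i) ->
  `|f y - f x| <= \sum_i M i * `|y ord0 i - x ord0 i|.
Proof.
move=> sf fM.
pose z (k : nat) : 'rV[R]_n := \row_j (if (j < k)%N then y ord0 j else x ord0 j).
have -> : f y = f (z n).
  by congr f; apply/rowP => j; rewrite mxE ltn_ord.
have -> : f x = f (z 0%N) by congr f; apply/rowP => j; rewrite mxE.
have -> : f (z n) - f (z 0%N) = \sum_(i < n) (f (z i.+1) - f (z i)).
  by rewrite -(big_mkord xpredT (fun k => f (z k.+1) - f (z k))) telescope_sumr.
apply: le_trans (ler_norm_sum _ _ _) _; apply: ler_sum => i _.
have zS : z i.+1 = z i + (y ord0 i - x ord0 i) *: delta_mx ord0 i.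
  apply/rowP => j; rewrite !mxE eqxx /= ltnS leq_eqVlt.
  have [->|ij] := eqVneq i j; first by rewrite eqxx ltnn /= mulr1 addrC subrK.
  rewrite (negbTE (_ : nat_of_ord j != i)); last first.
    by rewrite eq_sym; apply: contra_neq ij; exact: val_inj.
  by rewrite mulr0 addr0.
have [t th E] := smooth_line_MVT (z i) i (y ord0 i - x ord0 i) sf.
rewrite zS E normrM ler_wpM2r//; apply: fM => j.
rewrite !mxE eqxx /=.
have [<-|ij] := eqVneq i j.
  rewrite ltnn mulr1; move: th; rewrite !ge_min !le_max.
  by move: (x ord0 i) (y ord0 i) => a b; lra.
rewrite mulr0 addr0; case: ifP => _.
  by rewrite ge_min lexx orbT le_max lexx orbT.
by rewrite ge_min lexx le_max lexx.
Qed.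

End increments.

(** * Uniform estimates on compact sets *)

Section compactness.
Context {R : realType} {n : nat}.
Implicit Types (K U : set 'rV[R]_n) (x y : 'rV[R]_n).

(** A Lebesgue number argument, shared by the distance from a compact set to the complement of an
    open one and by uniform continuity. Asking for [P y z] with both points near [x] allows the
    first of them to become the moving centre in the conclusion. *)
Lemma compact_uniform K (P : 'rV[R]_n -> 'rV[R]_n -> Prop) : compact K ->
  (forall x, K x -> exists2 e : R, 0 < e & forall y z : 'rV[R]_n,
    (forall i, `|x ord0 i - y ord0 i| < e) ->
    (forall i, `|x ord0 i - z ord0 i| < e) -> P y z) ->
  exists2 d : R, 0 < d & forall x y, K x ->
    (forall i, `|x ord0 i - y ord0 i| < d) -> P x y.
Proof.
move=> /compact_near_coveringP cK KP.
have : \forall d \near (0 : R)^'+, K `<=` (fun x => forall y,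
    (forall i, `|x ord0 i - y ord0 i| < d) -> P x y).
  apply: cK => x Kx; have [e e0 xP] := KP x Kx.
  have e20 : 0 < e / 2 by rewrite divr_gt0.
  exists (ball x (e / 2), [set d | 0 < d] `&` [set d | d < e / 2]) => /=.
    split; first exact: nbhsx_ballx.
    by apply: filterI; [exact: nbhs_right_gt|exact: nbhs_right_lt].
  move=> [y d] /= [/ball_rVP[_ xy] [d0 de]] z yz.
  apply: xP => i; first by apply: lt_trans (xy i) _; lra.
  have := xy i; have := yz i; rewrite !ltr_norml.
  by move: (x ord0 i) (y ord0 i) (z ord0 i) => a b c; lra.
move=> /(filterI (nbhs_right_gt (0 : R)))/filter_ex[d [d0 dP]].
by exists d => // x y Kx; exact: dP.
Qed.

Lemma compact_sub_open K U : compact K -> open U -> K `<=` U ->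
  exists2 d : R, 0 < d & forall x y, K x ->
    (forall i, `|x ord0 i - y ord0 i| < d) -> U y.
Proof.
move=> cK oU KU; apply: (compact_uniform (P := fun _ y => U y)) => // x /KU Ux.
by have /nbhs_rVP[e e0 eU] := oU _ Ux; exists e => // y z _; exact: eU.
Qed.

Lemma compact_modulus K m (g : 'I_m -> 'rV[R]_n -> R) (e : R) :
  compact K -> (forall i, continuous (g i)) -> 0 < e ->
  exists2 d : R, 0 < d & forall x y, K x ->
    (forall i, `|x ord0 i - y ord0 i| < d) -> forall i, `|g i x - g i y| < e.
Proof.
move=> cK cg e0.
apply: (compact_uniform (P := fun x y => forall i, `|g i x - g i y| < e)) => //.
move=> x _; have : \forall y \near x, forall i, `|g i x - g i y| < e / 2.
  have gi i : \forall y \near x, `|g i x - g i y| < e / 2.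
    by have /cvgrPdist_lt := cg i x; apply; rewrite divr_gt0.
  exact: (filter_forall _ gi).
move=> /nbhs_rVP[d d0 dP]; exists d => // y z xy xz i.
by have := dP _ xy i; have := dP _ xz i; rewrite !ltr_norml;
  move: (g i x) (g i y) (g i z) => a b c; lra.
Qed.

Lemma compact_fun_bounded K m (g : 'I_m -> 'rV[R]_n -> R) : compact K ->
  (forall i, continuous (g i)) ->
  exists2 M : R, 0 < M & forall i x, K x -> `|g i x| <= M.
Proof.
move=> cK cg.
have b i : exists M : R, 0 < M /\ forall x, K x -> `|g i x| <= M.
  have : compact (g i @` K).
    by apply: continuous_compact => //; exact: continuous_subspaceT.
  move=> /compact_bounded[M [_ gM]]; exists (`|M| + 1); split; first exact: ltr_pwDr.
  move=> x Kx; apply: (gM (`|M| + 1)); last by exists x.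
  by apply: le_lt_trans (ler_norm M) _; rewrite ltrDl.
have [M MP] := choice b.
exists (1 + \sum_i M i).
  by rewrite ltr_pwDl// sumr_ge0// => i _; have [/ltW] := MP i.
move=> i x Kx; have [_ /(_ x Kx) gx] := MP i; apply: (le_trans gx).
rewrite (bigD1 i)//= addrCA lerDl addr_ge0// sumr_ge0// => j _.
by have [/ltW] := MP j.
Qed.

Lemma compact_sub_box K : compact K ->
  exists2 L : R, 0 < L & forall x i, K x -> `|x ord0 i| <= L.
Proof.
move=> cK.
have [L L0 LP] := compact_fun_bounded (m := n)
  (g := fun i x => x ord0 i) cK (fun i => @coord_continuous _ _ _ ord0 i).
by exists L => // x i; exact: LP.
Qed.

Lemma compact_box (L : R) :
  compact [set x : 'rV[R]_n | forall i, -L <= x ord0 i <= L].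
Proof.
have := @rV_compact R n (fun _ => `[- L, L]%classic) (fun _ => @segment_compact _ _ _).
congr compact; apply/seteqP; split=> x xL i; have := xL i; by rewrite /= in_itv.
Qed.

End compactness.

(** * Grids and Hausdorff gauges *)

Section enorm.
Context {R : realType} {n : nat}.
Implicit Types (v : 'rV[R]_n).

Lemma enorm_ge0 v : 0 <= enorm v. Proof. exact: sqrtr_ge0. Qed.

Lemma coord_le_enorm v i : `|v ord0 i| <= enorm v.
Proof.
rewrite -sqrtr_sqr ler_wsqrtr// (bigD1 i)//= lerDl sumr_ge0// => j _.
exact: sqr_ge0.
Qed.

Lemma enorm_le_sum v : enorm v <= \sum_i `|v ord0 i|.
Proof.
have s0 : 0 <= \sum_i `|v ord0 i| by rewrite sumr_ge0.
rewrite -[leRHS]ger0_norm// -sqrtr_sqr ler_wsqrtr// expr2 mulr_suml.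
apply: ler_sum => i _; rewrite -real_normK ?num_real// expr2 ler_wpM2l//.
by rewrite (bigD1 i)//= lerDl sumr_ge0.
Qed.

Lemma measurable_unit_ball : measurable [set v : 'rV[R]_n | enorm v < 1].
Proof.
rewrite (_ : mkset _ = (fun v : 'rV[R]_n => \sum_(i < n) rV_coord i v ^+ 2) @^-1`
    `]-oo, 1[%classic); last first.
  have E v : (enorm v < 1) = (\sum_(i < n) rV_coord i v ^+ 2 < 1).
    by rewrite /enorm -{1}(@sqrtr1 R) ltr_sqrt.
  by apply/seteqP; split=> v /=; rewrite in_itv/= E.
rewrite -[X in measurable X]setTI.
have : measurable_fun setT (fun v : 'rV[R]_n => \sum_(i < n) rV_coord i v ^+ 2).
  apply: measurable_sum => i; apply: measurable_funX.
  exact: measurable_rV_coord.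
by apply.
Qed.

(** Volume of the circumscribed cube. The exact normalization of the Hausdorff gauge would only
    change the final constant. *)
Lemma unit_ball_le : (lebesgue_rV n [set v : 'rV[R]_n | (enorm v < 1)%R]
  <= (2 ^+ n)%:E)%E.
Proof.
rewrite -(@lebesgue_cube _ n (const_mx (- 1)))//; apply: le_measure; rewrite ?inE.
- exact: measurable_unit_ball.
- exact: measurable_cube.
move=> v /= v1 i; have := le_lt_trans (coord_le_enorm v i) v1.
by rewrite mxE ltr_norml; move: (v ord0 i) => a; lra.
Qed.

End enorm.

Section hausdorff_gauge.
Context {R : realType} {n : nat}.

(** The empty [Q], of diameter [-oo], is allowed: coverings by finitely many cubes are later padded
    with empty sets. *)
Lemma diameter_cube (a : 'rV[R]_n) (s : R) (Q : set 'rV[R]_n) : Q `<=` cube a s ->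
  (diameter Q <= (n%:R * s)%:E)%E.
Proof.
move=> Qas; apply: ge_ereal_sup => _ [[p q] /= [/Qas ap /Qas aq] <-].
rewrite lee_fin; apply: le_trans (enorm_le_sum _) _.
rewrite [leRHS](_ : _ = \sum_(i < n) s); last first.
  by rewrite sumr_const card_ord mulr_natl.
apply: ler_sum => i _; rewrite !mxE.
have := ap i; have := aq i; rewrite ler_norml.
by move: (p ord0 i) (q ord0 i) (a ord0 i) => b c d; lra.
Qed.

Lemma diameter_ge0 (Q : set 'rV[R]_n) : Q !=set0 -> (0 <= diameter Q)%E.
Proof.
move=> [p Qp]; apply: ereal_sup_ubound; exists (p, p) => //=.
rewrite subrr /enorm; congr EFin; apply/eqP; rewrite sqrtr_eq0.
by rewrite big1// => i _; rewrite mxE expr0n.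
Qed.

Lemma hausdorff_gauge0 k : hausdorff_gauge k (set0 : set 'rV[R]_n) = 0%E.
Proof. by rewrite /hausdorff_gauge eqxx. Qed.

Lemma hausdorff_gauge_ge0 k (Q : set 'rV[R]_n) : (0 <= hausdorff_gauge k Q)%E.
Proof.
rewrite /hausdorff_gauge; case: ifPn => // /set0P Q0.
rewrite mule_ge0//; apply: expe_ge0; rewrite mule_ge0//; exact: diameter_ge0.
Qed.

Lemma hausdorff_gauge_cube k (a : 'rV[R]_n) (s : R) (Q : set 'rV[R]_n) : 0 <= s ->
  Q `<=` cube a s ->
  (hausdorff_gauge k Q <= (2 ^+ k * (n%:R * s) ^+ k)%:E)%E.
Proof.
move=> s0 Qas; rewrite /hausdorff_gauge; case: ifPn => [_|/set0P Q0].
  by rewrite lee_fin mulr_ge0// exprn_ge0// mulr_ge0.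
have := diameter_ge0 Q0; have := diameter_cube Qas.
case: (diameter Q) => // d; rewrite !lee_fin => dle d0.
rewrite EFinM; apply: lee_pmul => //.
  by apply: expe_ge0; rewrite -EFinM lee_fin mulr_ge0.
  exact: unit_ball_le.
rewrite -EFinM -EFin_expe lee_fin; apply: lerXn2r; rewrite ?nnegrE ?mulr_ge0//.
by apply: le_trans dle; rewrite ler_piMl// invf_le1// ler1n.
Qed.

End hausdorff_gauge.

Section grid.
Context {R : realType} {n : nat}.
Variables (L : R) (M : nat).
Hypotheses (L0 : 0 < L) (M0 : (0 < M)%N).

Definition mesh : R := 2 * L / M%:R.
Definition grid_corner (j : {ffun 'I_n -> 'I_M}) : 'rV[R]_n :=
  \row_i (- L + (j i)%:R * mesh).
Definition grid_cube j := cube (grid_corner j) mesh.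

Lemma mesh_gt0 : 0 < mesh.
Proof. by rewrite divr_gt0 ?ltr0n// mulr_gt0. Qed.

Lemma mesh_total : M%:R * mesh = 2 * L.
Proof. by rewrite /mesh mulrC divfK// pnatr_eq0 -lt0n. Qed.

Lemma grid_cover (x : 'rV[R]_n) : (forall i, - L <= x ord0 i < L) ->
  exists j, grid_cube j x.
Proof.
move=> xL; have m0 := mesh_gt0.
have jP i : (Num.truncn ((x ord0 i + L) / mesh) < M)%N.
  rewrite -(@ltr_nat R).
  apply: le_lt_trans (_ : (x ord0 i + L) / mesh < _).
    have /andP[h1 h2] := xL i.
    have : 0 <= (x ord0 i + L) / mesh by apply: divr_ge0; [lra|exact: ltW].
    by move=> /truncn_itv/andP[].
  rewrite ltr_pdivrMr// mesh_total; have := xL i; move: (x ord0 i) => a; lra.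
exists [ffun i => Ordinal (jP i)] => i; rewrite !mxE ffunE /=.
have /andP[h1 h2] := xL i.
have : 0 <= (x ord0 i + L) / mesh by apply: divr_ge0; [lra|exact: ltW].
move=> /truncn_itv/andP[]; move: (Num.truncn _) => k.
rewrite ler_pdivlMr// ltr_pdivrMr// -natr1 mulrDl mul1r.
move: (x ord0 i) (k%:R * mesh) => a b ab1 ab2; apply/andP; split; lra.
Qed.

Lemma grid_disjoint (x : 'rV[R]_n) j k : grid_cube j x -> grid_cube k x -> j = k.
Proof.
move=> jx kx; apply/ffunP => i; apply/val_inj/eqP.
have m0 := mesh_gt0.
have H (a b : nat) : a%:R * mesh < b%:R * mesh + mesh -> (a <= b)%N.
  move=> ab; have : a%:R * mesh < b.+1%:R * mesh by rewrite -natr1 mulrDl mul1r.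
  by rewrite ltr_pM2r// ltr_nat ltnS.
have := jx i; have := kx i; rewrite !mxE eqn_leq => /andP[h1 h2] /andP[h3 h4].
by apply/andP; split; apply: H;
  move: (_%:R * mesh) (_%:R * mesh) (x ord0 i) h1 h2 h3 h4 => a b c; lra.
Qed.

Lemma grid_cube_box j (x : 'rV[R]_n) : grid_cube j x ->
  forall i, - L <= x ord0 i < L.
Proof.
move=> jx i; have := jx i; rewrite !mxE => /andP[h1 h2].
have m0 := mesh_gt0.
have h3 : 0 <= (j i)%:R * mesh by rewrite mulr_ge0// ltW.
have h4 : (j i)%:R * mesh + mesh <= 2 * L.
  rewrite -mesh_total -{2}[mesh]mul1r -mulrDl natr1 ler_wpM2r ?ler_nat//.
  exact: ltW.
by apply/andP; split; move: (_%:R * mesh) (x ord0 i) h1 h2 h3 h4 => a b; lra.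
Qed.

Lemma grid_corner_mem j : grid_cube j (grid_corner j).
Proof. by move=> i; rewrite lexx ltrDl mesh_gt0. Qed.

Lemma grid_cube_near j (x y : 'rV[R]_n) : grid_cube j x -> grid_cube j y ->
  forall i, `|x ord0 i - y ord0 i| < mesh.
Proof.
move=> jx jy i; have := jx i; have := jy i; rewrite ltr_norml.
by move: (grid_corner j ord0 i) (x ord0 i) (y ord0 i) => a b c; lra.
Qed.

(** Guarantees that the coordinate path of [coord_increments] between two points of a grid cube does
    not leave this cube. *)
Lemma between_grid_cube j (x y z : 'rV[R]_n) : grid_cube j x -> grid_cube j y ->
  (forall i, Num.min (x ord0 i) (y ord0 i) <= z ord0 i
     <= Num.max (x ord0 i) (y ord0 i)) -> grid_cube j z.
Proof.
move=> jx jy xyz i; have := jx i; have := jy i; have := xyz i.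
rewrite ge_min le_max; move: (grid_corner j ord0 i) => a.
by move: (x ord0 i) (y ord0 i) (z ord0 i) => b c d; lra.
Qed.

Lemma lebesgue_grid_cube j : lebesgue_rV n (grid_cube j) = (mesh ^+ n)%:E.
Proof. by rewrite lebesgue_cube// ltW// mesh_gt0. Qed.

Lemma card_grid : #|{: {ffun 'I_n -> 'I_M}}| = (M ^ n)%N.
Proof. by rewrite card_ffun !card_ord. Qed.

End grid.

Lemma bigsetU_subadditive d (T : measurableType d) (R : realType)
    (mu : {measure set T -> \bar R}) (I : Type) (r : seq I) (F : I -> set T) :
  (forall i, measurable (F i)) ->
  (mu (\big[setU/set0]_(i <- r) F i) <= \sum_(i <- r) mu (F i))%E.
Proof.
move=> mF; elim: r => [|i r IH]; first by rewrite !big_nil measure0.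
rewrite !big_cons; apply: (@le_trans _ _ (mu (F i) + mu (\big[setU/set0]_(j <- r) F j))%E).
  by apply: measureU2 => //; exact: bigsetU_measurable.
by rewrite leeD2l.
Qed.

(** * A parametric Sard theorem *)

Section smooth_more.
Context {R : realType} {n : nat}.
Implicit Types (f g : 'rV[R]_n -> R).

Lemma smooth_sum (I : Type) (r : seq I) (F : I -> 'rV[R]_n -> R) :
  (forall i, smooth_on setT (F i)) ->
  smooth_on setT (fun x => \sum_(i <- r) F i x).
Proof.
move=> sF; elim: r => [|i r IH].
  rewrite (_ : (fun _ => _) = cst 0); first exact: smooth_cst.
  by apply/funext => x; rewrite big_nil.
rewrite (_ : (fun _ => _) = F i \+ (fun x => \sum_(j <- r) F j x)).
  exact: smoothD.
by apply/funext => x; rewrite big_cons.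
Qed.

Lemma smoothZ (c : R) f : smooth_on setT f -> smooth_on setT (fun x => c * f x).
Proof. by move=> sf; exact: (smoothM (smooth_cst c) sf). Qed.

Lemma smoothB f g : smooth_on setT f -> smooth_on setT g ->
  smooth_on setT (fun x => f x - g x).
Proof.
move=> sf sg.
rewrite (_ : (fun _ => _) = f \+ (fun x => -1 * g x)).
  by apply: smoothD => //; exact: smoothZ.
by apply/funext => x /=; rewrite mulN1r.
Qed.

Lemma pderivZ (c : R) f i : smooth_on setT f ->
  pderiv i (fun x => c * f x) = (fun x => c * pderiv i f x).
Proof.
move=> sf; rewrite (pderivM i (smooth_cst c) sf) pderiv_cst.
by apply/funext => x /=; rewrite mulr0 addr0.
Qed.

Lemma pderivB f g i : smooth_on setT f -> smooth_on setT g ->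
  pderiv i (fun x => f x - g x) = (fun x => pderiv i f x - pderiv i g x).
Proof.
move=> sf sg; rewrite (_ : (fun _ => _) = f \+ (fun x => -1 * g x)).
  rewrite pderivD//; last exact: smoothZ.
  by rewrite pderivZ//; apply/funext => x /=; rewrite mulN1r.
by apply/funext => x /=; rewrite mulN1r.
Qed.

Lemma pderiv_sum (I : Type) (r : seq I) (F : I -> 'rV[R]_n -> R) i :
  (forall j, smooth_on setT (F j)) ->
  pderiv i (fun x => \sum_(j <- r) F j x) = (fun x => \sum_(j <- r) pderiv i (F j) x).
Proof.
move=> sF; elim: r => [|j r IH].
  rewrite (_ : (fun _ => _) = cst 0); last by apply/funext => x; rewrite big_nil.
  by rewrite pderiv_cst; apply/funext => x; rewrite big_nil.
rewrite (_ : (fun _ => _) = F j \+ (fun x => \sum_(k <- r) F k x)).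
  rewrite pderivD//; last exact: smooth_sum.
  by rewrite IH; apply/funext => x; rewrite big_cons.
by apply/funext => x; rewrite big_cons.
Qed.

Definition dot (a x : 'rV[R]_n) : R := \sum_i a ord0 i * x ord0 i.

Lemma smooth_dot a : smooth_on setT (dot a).
Proof. by apply: smooth_sum => i; apply: smoothZ; exact: smooth_coord. Qed.

Lemma pderiv_dot a i x : pderiv i (dot a) x = a ord0 i.
Proof.
rewrite pderiv_sum; last by move=> j; apply: smoothZ; exact: smooth_coord.
rewrite (bigD1 i)//= big1 => [|j ji]; rewrite pderivZ ?pderiv_coord//=;
  try exact: smooth_coord.
  by rewrite eqxx mulr1 addr0.
by rewrite eq_sym (negbTE ji) mulr0.
Qed.

(* Only constants are lost in replacing the Euclidean norm of the gradient by
   its l^1 norm. *)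
Definition grad1 f x : R := \sum_i `|pderiv i f x|.

Lemma grad1_ge0 f x : 0 <= grad1 f x. Proof. exact: sumr_ge0. Qed.

Lemma grad1_continuous f : smooth_on setT f -> continuous (grad1 f).
Proof.
move=> sf; rewrite /grad1; elim: (index_enum _) => [|i r IH] x.
  rewrite (_ : (fun _ => _) = cst 0); first exact: cst_continuous.
  by apply/funext => y; rewrite big_nil.
rewrite (_ : (fun _ => _) = (fun y => `|pderiv i f y|) \+
    (fun y => \sum_(j <- r) `|pderiv j f y|)); last first.
  by apply/funext => y; rewrite big_cons.
have ci : (fun y => `|pderiv i f y|) @ x --> `|pderiv i f x|.
  have h := @smooth_continuous _ _ _ (smooth_pderiv i sf) x.
  exact: (cvg_norm h).
exact: cvgD ci (IH x).
Qed.

Lemma measurable_grad1 f : smooth_on setT f -> measurable_fun setT (grad1 f).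
Proof. by move=> sf; apply: continuous_measurable_rV; exact: grad1_continuous. Qed.

End smooth_more.

Section parametric_sard.
Context {R : realType} {n : nat}.

(* [x] is a critical point of [w - dot a] at level [t] iff
   [(a, t)] is the image of [x] under the smooth map displayed in the
   conclusion; this map goes from dimension [n] to dimension [n.+1], so its
   range is negligible, whence a Sard theorem for almost every [a]. *)
Lemma critical_pairs_small (w : 'rV[R]_n -> R) (L eta : R) :
  smooth_on setT w -> 0 < L -> 0 < eta ->
  exists S : set ('rV[R]_n * measurableTypeR R),
    [/\ measurable S, ((lebesgue_rV n \x lebesgue_measure) S <= eta%:E)%E &
      forall x : 'rV[R]_n, (forall i, - L <= x ord0 i < L) ->
        S (grad w x, w x - dot (grad w x) x)].
Proof.
move=> sw L0 eta0.
pose phi x := w x - \sum_i (pderiv i w x * x ord0 i).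
have sphi : smooth_on setT phi.
  apply: smoothB => //; apply: smooth_sum => i.
  by apply: (smoothM (smooth_pderiv i sw)); exact: smooth_coord.
(* The map from dimension [n] to [n.+1], in components: the level [phi] at index [ord0], the
   gradient at the others. *)
pose h (k : 'I_n.+1) : 'rV[R]_n -> R :=
  if unlift ord0 k is Some i then pderiv i w else phi.
have sh k : smooth_on setT (h k).
  by rewrite /h; case: unlift => // i; exact: smooth_pderiv.
have bnd : exists2 La : R, 0 < La &
    forall k i (x : 'rV[R]_n), (forall i, - L <= x ord0 i <= L) ->
      `|pderiv i (h k) x| <= La.
  have H (k : 'I_n.+1) : exists La : R, 0 < La /\ forall i (x : 'rV[R]_n),
      (forall i, - L <= x ord0 i <= L) -> `|pderiv i (h k) x| <= La.
    have [La La0 LaP] := compact_fun_bounded (g := fun i => pderiv i (h k))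
      (@compact_box R n L) (fun i => smooth_continuous (smooth_pderiv i (sh k))).
    by exists La.
  have [La LaP] := choice H.
  exists (1 + \sum_k La k).
    by rewrite ltr_pwDl// sumr_ge0// => k _; have [/ltW] := LaP k.
  move=> k i x xL; have [_ /(_ i x xL) le1] := LaP k.
  apply: (le_trans le1); rewrite (bigD1 k)//= addrCA lerDl addr_ge0// sumr_ge0//.
  by move=> j _; have [/ltW] := LaP j.
have [La La0 LaP] := bnd.
(* Chosen so that [2 * rho = kap / M]. The [M ^ n] grid cubes have their images in boxes of volume
   [(kap / M) ^+ n.+1], in total [kap ^+ n.+1 / M]; the surplus dimension leaves the factor
   [1 / M]. *)
pose kap := 4 * n.+1%:R * La * L.
have kap0 : 0 < kap by rewrite /kap !mulr_gt0// ltr0n.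
pose M := (Num.truncn (kap ^+ n.+1 / eta)).+1.
have M0 : (0 < M)%N by [].
have MP : kap ^+ n.+1 / eta < M%:R.
  have /truncn_itv/andP[] : 0 <= kap ^+ n.+1 / eta; last by [].
  by rewrite divr_ge0// ?exprn_ge0// ltW.
pose s := mesh L M; have s0 : 0 < s by exact: mesh_gt0.
(* The oscillation on a cube is at most [n%:R * La * s]; the larger factor [n.+1] makes it strictly
   less than [rho], as the half-open boxes [B j] require. *)
pose rho := n.+1%:R * La * s.
have rho0 : 0 < rho by apply: mulr_gt0 => //; apply: mulr_gt0.
have h_osc j k x : grid_cube L (M:=M) j x ->
    `|h k x - h k (grid_corner L j)| < rho.
  move=> jx; have jc := grid_corner_mem (n:=n) L0 M0 j.
  apply: le_lt_trans (_ : n%:R * La * s < rho); last first.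
    by rewrite /rho -!mulrA ltr_pM2r ?ltr_nat// mulr_gt0.
  apply: le_trans (coord_increments (M := fun _ => La) (sh k) _) _.
    move=> i z zb; apply: LaP => i'.
    have /grid_cube_box : grid_cube L (M:=M) j z by apply: (between_grid_cube jc jx).
    by move=> /(_ L0 M0 i')/andP[-> /ltW ->].
  rewrite -mulrA mulr_natl -[in leRHS](card_ord n) -sumr_const.
  apply: ler_sum => i _; rewrite ler_wpM2l ?ltW//.
  exact: (grid_cube_near jx jc).
pose B (j : {ffun 'I_n -> 'I_M}) : set ('rV[R]_n * measurableTypeR R) :=
  cube (grad w (grid_corner L j) - const_mx rho) (2 * rho) `*`
  `[phi (grid_corner L j) - rho, phi (grid_corner L j) + rho[%classic.
have mB j : measurable (B j) by apply: measurableX => //; exact: measurable_cube.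
have mu_B j : (lebesgue_rV n \x lebesgue_measure)%E (B j) = ((2 * rho) ^+ n.+1)%:E.
  rewrite product_measure1E//; last exact: measurable_cube.
  rewrite [X in (X * _)%E](lebesgue_cube _ (s := 2 * rho)); last by rewrite mulr_ge0// ltW.
  rewrite [X in (_ * X)%E]lebesgue_measure_itv/= lte_fin ifT; last by lra.
  by rewrite -EFinB -EFinM exprSr; congr ((_ * _)%:E); lra.
exists (\big[setU/set0]_(j : {ffun 'I_n -> 'I_M}) B j); split.
- exact: bigsetU_measurable.
- apply: le_trans (bigsetU_subadditive _ _ _) _ => //.
  rewrite (eq_bigr (fun=> ((2 * rho) ^+ n.+1)%:E)); last by move=> j _; exact: mu_B.
  rewrite sumEFin lee_fin sumr_const card_grid.
  have -> : 2 * rho = kap / M%:R.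
    rewrite /rho /kap /s /mesh; move: (n.+1%:R : R) (M%:R^-1 : R) => a b; lra.
  rewrite expr_div_n -[_ *+ (M ^ n)%N]mulr_natl natrX [M%:R ^+ n.+1]exprSr.
  move: MP; rewrite ltr_pdivrMr// => /ltW; set k := kap ^+ n.+1.
  have MR : (M%:R : R) != 0 by rewrite pnatr_eq0.
  have MnR : (M%:R ^+ n : R) != 0 by rewrite expf_neq0.
  rewrite (_ : _ * (k / _) = k / M%:R); last by field; rewrite MnR MR.
  by rewrite ler_pdivrMr ?ltr0n// mulrC.
- move=> x /(grid_cover L0 M0)[j jx]; rewrite -bigcup_seq; exists j.
    by rewrite /= mem_index_enum.
  split=> /=.
    move=> i; have := h_osc j (lift ord0 i) x jx; rewrite /h liftK !mxE ltr_norml.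
    by move: (pderiv _ _ _) (pderiv _ _ _) => a b; lra.
  have := h_osc j ord0 x jx; rewrite /h unlift_none in_itv /= ltr_norml.
  rewrite (_ : dot _ _ = \sum_i (pderiv i w x * x ord0 i)); last first.
    by apply: eq_bigr => i _; rewrite mxE.
  by rewrite -/(phi x); move: (phi _) (phi _) => a b; lra.
Qed.

End parametric_sard.

(** * The coarea inequality and good levels *)

Lemma eseries_finite_support (R : realType) (u : (\bar R)^nat) (m : nat) :
  (forall i, (m <= i)%N -> u i = 0%E) ->
  (\sum_(0 <= i <oo) u i = \sum_(0 <= i < m) u i)%E.
Proof.
move=> u0; apply: lim_near_cst => //.
exists m => // k /= mk; rewrite (@big_cat_nat _ _ _ m)//=.
rewrite [X in (_ + X)%E](_ : _ = 0%E) ?adde0//.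
by rewrite big_nat_cond big1// => i /andP[/andP[/u0 ->]].
Qed.

Section coarea.
Context {R : realType} {n : nat}.
Local Notation N := n.+1.

(** The first 2 comes from the length [2 * rho] of the interval of levels of a cube, [2 ^+ n] bounds
    the volume of the unit ball in the gauge, and [N%:R ^+ n] comes from the bound [N%:R * s] for
    the diameter of a cube of side [s]. *)
Definition coarea_const : R := 2 * (2 ^+ n * N%:R ^+ n).

Lemma coarea_const_gt0 : 0 < coarea_const.
Proof. by rewrite !mulr_gt0// exprn_gt0// ltr0n. Qed.

(* [g t] is the Hausdorff sum of the cubes [Q] of a fine grid that may meet
   the level [t]; the levels of [Q] fill an interval of length
   [O(side Q * sup_Q |grad f|)], so [int g] is a Riemann sum of [|grad f|]. *)
Lemma coarea_cover (f : 'rV[R]_N -> R) (K U : set 'rV[R]_N) (L eta : R) :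
  smooth_on setT f -> compact K -> open U -> K `<=` U ->
  (forall x i, U x -> - L <= x ord0 i < L) -> 0 < L -> 0 < eta ->
  exists g : measurableTypeR R -> \bar R, [/\ measurable_fun setT g,
    forall t, (0 <= g t)%E,
    forall t A, A `<=` K -> (forall x, A x -> f x = t) ->
      (hausdorff_premeasure n eta A <= g t)%E &
    (\int[lebesgue_measure]_t g t <= coarea_const%:E *
      (\int[lebesgue_rV N]_(x in U) (grad1 f x)%:E + eta%:E))%E].
Proof.
move=> sf cK oU KU UL L0 eta0.
(* Allowed oscillation of each partial derivative on a cube. It is paid twice for each of the [N]
   derivatives, in passing from the cube to its corner and from the corner back to [x]; over a box
   of volume [(2 * L) ^+ N] this amounts to [eta]. *)
pose e := eta / (2 * N%:R * (2 * L) ^+ N).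
have den0 : 0 < 2 * N%:R * (2 * L) ^+ N by rewrite !mulr_gt0// exprn_gt0// mulr_gt0.
have e0 : 0 < e by rewrite divr_gt0.
have [d1 d10 d1P] := compact_modulus (g := fun i => pderiv i f)
  (@compact_box R N L) (fun i => smooth_continuous (smooth_pderiv i sf)) e0.
have [d2 d20 d2P] := compact_sub_open cK oU KU.
(* The three bounds control the oscillation of the derivatives, keep the cubes that meet [K] inside
   [U], and make the diameters at most [eta]. *)
pose d := Num.min d1 (Num.min d2 (eta / N%:R)).
have d0 : 0 < d by rewrite !lt_min d10 d20 divr_gt0.
pose M := (Num.truncn (2 * L / d)).+1.
have M0 : (0 < M)%N by [].
have MP : mesh L M < d.
  rewrite /mesh ltr_pdivrMr ?ltr0n// [d * _]mulrC -ltr_pdivrMr//.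
  by have /truncn_itv/andP[] : 0 <= 2 * L / d by rewrite divr_ge0 ?mulr_ge0// ltW.
pose s := mesh L M; have s0 : 0 < s by exact: mesh_gt0.
have [sd1 sd2 sd3] : [/\ s < d1, s < d2 & N%:R * s < eta].
  move: MP; rewrite -/s !lt_min => /and3P[-> ->].
  by rewrite ltr_pdivlMr// mulrC.
pose Q := grid_cube (n := N) L (M := M).
pose c (j : {ffun 'I_N -> 'I_M}) := grid_corner L j.
have cQ j : Q j (c j) by exact: grid_corner_mem.
have sum_e : N%:R * e = \sum_(i < N) e by rewrite sumr_const card_ord mulr_natl.
pose G j := grad1 f (c j) + N%:R * e.
have G0 j : 0 <= G j by rewrite addr_ge0 ?grad1_ge0// mulr_ge0// ltW.
pose rho j := s * G j.
have rho0 j : 0 <= rho j by rewrite mulr_ge0// ltW.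
have Qbox j x : Q j x -> forall i, - L <= x ord0 i <= L.
  by move=> jx i; have /andP[-> /ltW ->] := grid_cube_box L0 M0 jx i.
have pd j x y i : Q j x -> Q j y -> `|pderiv i f x - pderiv i f y| < e.
  move=> jx jy; apply: d1P; first exact: Qbox jx.
  by move=> k; apply: lt_trans (grid_cube_near jx jy k) sd1.
have osc j x : Q j x -> `|f x - f (c j)| <= rho j.
  move=> jx.
  apply: le_trans (coord_increments (M := fun i => `|pderiv i f (c j)| + e) sf _) _.
    move=> i z zb; have jz : Q j z by apply: (between_grid_cube (cQ j) jx).
    have := ltW (pd j z (c j) i jz (cQ j)).
    have := ler_normD (pderiv i f z - pderiv i f (c j)) (pderiv i f (c j)).
    by rewrite subrK; move: (`|_|) (`|_|) (`|_|) => a b b'; lra.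
  rewrite /rho /G /grad1 sum_e -big_split/= mulr_sumr.
  apply: ler_sum => i _; rewrite mulrC ler_wpM2r//.
    by rewrite addr_ge0// ltW.
  exact/ltW/(grid_cube_near jx (cQ j)).
(* The cubes that meet [K] suffice to cover any part of [K], and being contained in [U] they allow
   the integral of the gradient to be taken over [U] only. *)
pose good j := `[< Q j `&` K !=set0 >].
have QU j : good j -> Q j `<=` U.
  move=> /asboolP[p [jp Kp]] y jy; apply: d2P Kp _ => k.
  by apply: lt_trans (grid_cube_near jp jy k) sd2.
pose w : R := 2 ^+ n * (N%:R * s) ^+ n.
have w0 : 0 <= w by rewrite mulr_ge0 ?exprn_ge0// mulr_ge0// ltW.
pose J j : set (measurableTypeR R) := `[f (c j) - rho j, f (c j) + rho j]%classic.
have mJ j : measurable (J j) by exact: measurable_itv.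
have mI j : measurable_fun setT (\1_(J j) : measurableTypeR R -> R).
  exact: measurable_indic.
pose g (t : measurableTypeR R) : \bar R :=
  (\sum_(j | good j) (w * \1_(J j) t)%:E)%E.
have mg1 j : measurable_fun setT (fun t : measurableTypeR R => (w * \1_(J j) t)%:E).
  apply/measurable_EFinP; exact: measurable_funM.
have g10 j t : (0 <= (w * \1_(J j) t)%:E)%E.
  by rewrite lee_fin mulr_ge0// indicE ler0n.
exists g; split.
- by rewrite /g; under eq_fun do rewrite -big_filter; exact: emeasurable_sum.
- by move=> t; exact: sume_ge0.
- move=> t A AK At.
  (* The cubes that may meet the level [t]. They are listed in [r] and the sequence is continued by
     empty sets, whose gauge is 0. *)
  pose P j := good j && (t \in J j).
  pose r := [seq j <- index_enum {ffun 'I_N -> 'I_M} | P j].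
  pose F i : set 'rV[R]_N := if (i < size r)%N then
    Q (nth [ffun _ => ord0] r i) else set0.
  apply: (@le_trans _ _ (\sum_(0 <= i <oo) hausdorff_gauge n (F i))%E).
    apply: ereal_inf_lbound; exists F => //; split.
      move=> x Ax; have [j jx] := grid_cover L0 M0 (fun i => UL x i (KU x (AK x Ax))).
      have jr : j \in r.
        rewrite mem_filter mem_index_enum andbT /P; apply/andP; split.
          by apply/asboolP; exists x; split => //; exact: AK.
        rewrite inE /J /= in_itv /= -(At x Ax).
        by have := osc j x jx; rewrite ler_norml; move: (f x) (f (c j)) => a b; lra.
      exists (index j r) => //; rewrite /F index_mem jr.
      by rewrite nth_index.
    move=> i; apply: (@le_trans _ _ (N%:R * s)%:E); last by rewrite lee_fin ltW.
    rewrite /F; case: ifP => _.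
      by apply: (@diameter_cube _ _ (c (nth [ffun _ => ord0] r i))) => ?.
    by apply: (@diameter_cube _ _ 0).
  rewrite (eseries_finite_support (m := size r)); last first.
    by move=> i ri; rewrite /F ltnNge ri /= hausdorff_gauge0.
  apply: (@le_trans _ _ (\sum_(0 <= i < size r) w%:E)%E).
    rewrite [leLHS]big_nat_cond [leRHS]big_nat_cond.
    apply: lee_sum => i /andP[/andP[_ ri] _]; rewrite /F ri.
    by apply: (hausdorff_gauge_cube _ (a := c (nth [ffun _ => ord0] r i)) (ltW s0)) => ?.
  rewrite big_mkord sumEFin sumr_const card_ord /g (bigID (fun j => t \in J j))/=.
  rewrite [X in (_ + X)%E]big1 ?adde0; last first.
    by move=> j /andP[_ /negbTE tJ]; rewrite indicE tJ mulr0.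
  rewrite (eq_bigr (fun=> w%:E)); last first.
    by move=> j /andP[_ tJ]; rewrite indicE tJ mulr1.
  by rewrite sumEFin -big_filter big_const_seq count_predT iter_addr_0.
(* A good cube contributes [w] times the length [2 * rho j], which is [coarea_const] times
   [s ^+ N * G j]. The latter is at most the integral over the cube of [h], the gradient plus the
   error [2 * N%:R * e]. *)
- have -> : (\int[lebesgue_measure]_t g t =
      \sum_(j | good j) (w * (2 * rho j))%:E)%E.
    rewrite /g; under eq_integral do rewrite -big_filter.
    rewrite ge0_integral_sum// big_filter; apply: eq_bigr => j _.
    under eq_integral do rewrite EFinM.
    rewrite ge0_integralZl_EFin//; last exact/measurable_EFinP.
    rewrite integral_indic// setIT /J [X in (_ * X)%E]lebesgue_measure_itv/= lte_fin.
    rewrite [RHS]EFinM; congr (_ * _)%E.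
    have [r0|] := ltP 0 (rho j).
      by rewrite ifT; [rewrite -EFinB; congr EFin; lra|lra].
    move=> r0; have -> : rho j = 0 by apply/eqP; rewrite eq_le r0 rho0.
    by rewrite subr0 addr0 ltxx mulr0.
  pose h (x : 'rV[R]_N) := (grad1 f x + 2 * N%:R * e)%:E.
  have h0 x : (0 <= h x)%E.
    rewrite /h lee_fin; apply: addr_ge0; first exact: grad1_ge0.
    by apply: mulr_ge0; [exact: mulr_ge0|exact: ltW].
  have mh : measurable_fun setT h.
    by apply/measurable_EFinP; apply: measurable_funD => //; exact: measurable_grad1.
  have mU : measurable U by exact: open_measurable_rV.
  have Gh j x : Q j x -> ((G j)%:E <= h x)%E.
    move=> jx; rewrite lee_fin /G /grad1.
    rewrite -mulrA [2 * _]mulr_natl mulr2n addrA lerD2r.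
    rewrite sum_e -big_split/=; apply: ler_sum => i _.
    have := ltW (pd j (c j) x i (cQ j) jx).
    have := ler_normD (pderiv i f (c j) - pderiv i f x) (pderiv i f x).
    by rewrite subrK; move: (`|_|) (`|_|) (`|_|) => a b b'; lra.
  have QG j : ((s ^+ N * G j)%:E <= \int[lebesgue_rV N]_(x in Q j) h x)%E.
    have <- : (\int[lebesgue_rV N]_(x in Q j) (cst (G j)%:E) x)%E = (s ^+ N * G j)%:E.
      rewrite integral_cst; last exact: measurable_cube.
      by rewrite [X in (_ * X)%E](lebesgue_grid_cube L0 M0) -EFinM mulrC.
    apply: ge0_le_integral => //; first exact: measurable_cube.
      by move=> x _; rewrite lee_fin.
      by apply: measurable_funS mh.
    by move=> x; exact: Gh.
  apply: (@le_trans _ _ (coarea_const%:E * \int[lebesgue_rV N]_(x in U) h x)%E).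
    have E j : (w * (2 * rho j))%:E = (coarea_const%:E * (s ^+ N * G j)%:E)%E.
      rewrite -EFinM; congr EFin; rewrite /w /rho /coarea_const exprMn [s ^+ N]exprS.
      by move: (_ ^+ n) (_ ^+ n) (_ ^+ n) => a b c'; ring.
    rewrite (eq_bigr _ (fun j _ => E j)) -ge0_sume_distrr; last first.
      by move=> j _; rewrite lee_fin mulr_ge0// exprn_ge0// ltW.
    rewrite lee_pmul2l ?lte_fin ?coarea_const_gt0//.
    apply: (@le_trans _ _ (\sum_(j | good j) \int[lebesgue_rV N]_(x in Q j) h x)%E).
      by apply: lee_sum => j _; exact: QG.
    rewrite -big_filter -(@ge0_integral_bigsetU _ _ _ _ _ Q).
    - apply: ge0_subset_integral => //.
      + by apply: bigsetU_measurable => j _; exact: measurable_cube.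
      + exact: measurable_funS mh.
      + rewrite -bigcup_seq => x [j /=]; rewrite mem_filter => /andP[gj _].
        exact: QU.
    - by move=> j; exact: measurable_cube.
    - by rewrite filter_uniq// index_enum_uniq.
    - move=> j k _ _ [x [jx kx]]; exact: grid_disjoint jx kx.
    - exact: measurable_funS mh.
    - by [].
  rewrite lee_pmul2l ?lte_fin ?coarea_const_gt0//.
  rewrite /h; under eq_integral do rewrite EFinD.
  rewrite ge0_integralD//; last 3 first.
  - by move=> x _; rewrite lee_fin grad1_ge0.
  - by apply/measurable_EFinP; apply: measurable_funS (measurable_grad1 sf).
  - by move=> x _; rewrite lee_fin; apply: mulr_ge0; [exact: mulr_ge0|exact: ltW].
  apply: leeD2l; rewrite integral_cst//.
  apply: (@le_trans _ _ ((2 * N%:R * e)%:E * (2 * L)%:E ^+ N)%E).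
    apply: lee_wpmul2l.
      by rewrite lee_fin; apply: mulr_ge0; [exact: mulr_ge0|exact: ltW].
    rewrite -EFin_expe -(@lebesgue_cube _ N (const_mx (- L))); last first.
      by apply: mulr_ge0 => //; exact: ltW.
    apply: (@le_measure _ _ _ (lebesgue_rV N)); rewrite ?inE//; first exact: measurable_cube.
    move=> x Ux i; rewrite mxE; have := UL x i Ux.
    by move: (x ord0 i) => a; lra.
  by rewrite -EFin_expe -EFinM lee_fin /e mulrAC mulrC divfK// gt_eqF.
Qed.

End coarea.

Section limn_einf_bounds.
Context {R : realType}.
Implicit Types (u : (\bar R)^nat) (x y : \bar R).

Lemma limn_einf_ge u x k0 : (forall k, (k0 <= k)%N -> (x <= u k)%E) ->
  (x <= limn_einf u)%E.
Proof.
move=> xu; rewrite limn_einf_lim (cvg_lim _ (@cvg_einfs_sup _ u))//.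
apply: (@le_trans _ _ (einfs u k0)); last by apply: ereal_sup_ubound; exists k0.
by apply: le_ereal_inf_tmp => _ [k /= k0k <-]; exact: xu.
Qed.

Lemma limn_einf_le u y : (forall k0, exists2 k, (k0 <= k)%N & (u k <= y)%E) ->
  (limn_einf u <= y)%E.
Proof.
move=> uy; rewrite limn_einf_lim (cvg_lim _ (@cvg_einfs_sup _ u))//.
apply: ge_ereal_sup => _ [k0 _ <-]; have [k k0k uk] := uy k0.
by apply: le_trans uk; apply: ereal_inf_lbound; exists k.
Qed.

End limn_einf_bounds.

(** * Superlevel sets: measurability, layer-cake formula, admissibility *)

Section superlevel.
Context {R : realType} {n : nat}.

Lemma measurable_subgraph (f : 'rV[R]_n -> R) : measurable_fun setT f ->
  measurable [set p : 'rV[R]_n * measurableTypeR R | p.2 < f p.1].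
Proof.
move=> mf; rewrite -[X in measurable X]setTI.
have m1 : measurable_fun setT (fun p : 'rV[R]_n * measurableTypeR R => f p.1).
  by apply: (measurableT_comp mf); exact: measurable_fst.
have m2 : measurable_fun setT (fun p : 'rV[R]_n * measurableTypeR R => p.2).
  exact: measurable_snd.
by have := measurable_fun_ltr m2 m1; move=> /(_ measurableT [set true]); apply.
Qed.

Lemma measurable_superlevel (U : set 'rV[R]_n) (f : 'rV[R]_n -> R) :
  measurable U -> measurable_fun setT f ->
  measurable_fun setT
    (fun t : measurableTypeR R => lebesgue_rV n (U `&` [set x | t < f x])).
Proof.
move=> mU mf.
pose W : set ('rV[R]_n * measurableTypeR R) :=
  (U `*` setT) `&` [set p | p.2 < f p.1].
have mW : measurable W.
  by apply: measurableI; [exact: measurableX|exact: measurable_subgraph].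
rewrite (_ : (fun _ => _) = lebesgue_rV n \o ysection W).
  exact: measurable_fun_ysection.
apply/funext => t /=; congr (lebesgue_rV n _); apply/seteqP; split=> x.
  by rewrite ysectionE => -[Ux tf]; split.
by rewrite ysectionE => -[[Ux _] tf].
Qed.

Lemma measurable_sublength (J : set (measurableTypeR R)) (f : 'rV[R]_n -> R) :
  measurable J -> measurable_fun setT f ->
  measurable_fun setT
    (fun x : 'rV[R]_n => lebesgue_measure (J `&` [set t | t < f x])).
Proof.
move=> mJ mf.
pose W : set ('rV[R]_n * measurableTypeR R) :=
  (setT `*` J) `&` [set p | p.2 < f p.1].
have mW : measurable W.
  by apply: measurableI; [exact: measurableX|exact: measurable_subgraph].
rewrite (_ : (fun _ => _) = lebesgue_measure \o xsection W).
  exact: measurable_fun_xsection.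
apply/funext => x /=; congr (lebesgue_measure _); apply/seteqP; split=> t.
  by rewrite xsectionE => -[Jt tf]; split.
by rewrite xsectionE => -[[_ Jt] tf].
Qed.

(** The layer-cake formula with the levels confined to [J]: both sides slice the part of [U] times
    [J] that lies below the graph of [f]. *)
Lemma tonelli_superlevel (U : set 'rV[R]_n) (J : set (measurableTypeR R))
    (f : 'rV[R]_n -> R) : measurable U -> measurable J -> measurable_fun setT f ->
  (\int[lebesgue_measure]_(t in J) lebesgue_rV n (U `&` [set x | t < f x]%R) =
   \int[lebesgue_rV n]_(x in U) lebesgue_measure (J `&` [set t | t < f x]%R))%E.
Proof.
move=> mU mJ mf.
pose W : set ('rV[R]_n * measurableTypeR R) :=
  (U `*` J) `&` [set p | p.2 < f p.1].
have mW : measurable W.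
  by apply: measurableI; [exact: measurableX|exact: measurable_subgraph].
have : ((lebesgue_rV n \x lebesgue_measure) W =
        (lebesgue_rV n \x^ lebesgue_measure) W)%E.
  by apply: product_measure_unique => // A B mA mB; exact: product_measure2E.
rewrite /product_measure1 /product_measure2 => E.
transitivity (\int[lebesgue_measure]_t (lebesgue_rV n (ysection W t)))%E.
  rewrite [RHS](_ : _ = \int[lebesgue_measure]_(t in setT)
    (((fun t => lebesgue_rV n (U `&` [set x | t < f x]%R)) \_ J) t))%E.
    by rewrite -integral_mkcond.
  apply: eq_integral => t _; rewrite patchE; case: ifPn => [|] tJ.
    congr (lebesgue_rV n _); apply/seteqP; split=> x.
      by rewrite ysectionE => -[[Ux _] tf]; split.
    by rewrite ysectionE => -[Ux tf]; split => //; split => //; rewrite inE in tJ.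
  rewrite (_ : ysection W t = set0) ?measure0//.
  apply/seteqP; split=> x //; rewrite ysectionE => -[[_ Jt] _].
  by move/negP: tJ; apply; rewrite inE.
rewrite -[LHS]E [LHS](_ : _ = \int[lebesgue_rV n]_(x in setT)
    (((fun x => lebesgue_measure (J `&` [set t | t < f x]%R)) \_ U) x))%E.
  by rewrite -integral_mkcond.
apply: eq_integral => x _; rewrite patchE /=; case: ifPn => [|] xU.
  congr (lebesgue_measure _); apply/seteqP; split=> t.
    by rewrite xsectionE => -[[_ Jt] tf]; split.
  by rewrite xsectionE => -[Jt tf]; split => //; split => //; rewrite inE in xU.
rewrite (_ : xsection W x = set0) ?measure0//.
apply/seteqP; split=> t //; rewrite xsectionE => -[[Ux _] _].
by move/negP: xU; apply; rewrite inE.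
Qed.

(** Confining the points of [closure U] with [t <= f] to the compact [K] keeps [closure E] inside
    [U], so the boundary of [E] lies on the level [t] and has no part on the boundary of [U]. Near a
    boundary point, [t - f] is a defining function on the open set where a partial derivative that
    is nonzero at this point does not vanish. *)
Lemma superlevel_admissible (f : 'rV[R]_n -> R) (U K Omega : set 'rV[R]_n) (t : R) :
  smooth_on setT f -> open U -> compact K -> K `<=` U -> K `<=` Omega ->
  (forall x, closure U x -> t <= f x -> K x) ->
  (forall x, U x -> f x = t -> grad f x != 0) ->
  let E := U `&` [set x | t < f x] in
  [/\ open E, smooth_boundary E, compactly_contained E Omega, boundary E `<=` K &
    forall x, boundary E x -> f x = t].
Proof.
move=> sf oU cK KU KO UK reg E.
have cf := smooth_continuous sf.
have opre (g : 'rV[R]_n -> R) (B : set R) : continuous g -> open B -> open (g @^-1` B).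
  by move=> cg oB; apply: open_comp => // x _; exact: cg.
have oE : open E.
  apply: openI => //; rewrite (_ : mkset _ = f @^-1` `]t, +oo[).
    by apply: opre => //; exact: interval_open.
  by apply/seteqP; split=> x; rewrite /= in_itv/= andbT.
have clE x : closure E x -> t <= f x.
  have : closed [set x | t <= f x].
    rewrite (_ : mkset _ = f @^-1` `[t, +oo[).
      by apply: closed_comp; [move=> y _; exact: cf|exact: interval_closed].
    by apply/seteqP; split=> y; rewrite /= in_itv/= andbT.
  move=> /closure_id cl Ex; suff : [set y | t <= f y] x by [].
  by rewrite cl; apply: closureS Ex => y [_] /=; exact: ltW.
have EK : closure E `<=` K.
  move=> x Ex; apply: UK (clE x Ex).
  by apply: closureS Ex => y [].
have bt x : boundary E x -> f x = t.
  move=> [Ex nEx]; apply/eqP; rewrite eq_le clE// andbT leNgt; apply/negP => tf.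
  apply: nEx; rewrite (interior_id E).1//; split=> //.
  exact/KU/EK.
have bK : boundary E `<=` K by move=> x [Ex _]; exact: EK.
split => //.
- move=> x bx; have Ux := KU _ (bK _ bx).
  have [i gi] : exists i, pderiv i f x != 0.
    apply: contrapT => /forallNP H; have := reg x Ux (bt x bx).
    move=> /eqP; apply; apply/rowP => i; rewrite !mxE.
    by have /negP := H i; rewrite negbK => /eqP.
  exists (U `&` [set y | pderiv i f y != 0]), (fun y => t - f y).
  have st : smooth_on setT (fun y => t - f y).
    by apply: smoothB => //; exact: smooth_cst.
  split.
  + apply: openI => //.
    rewrite (_ : mkset _ = pderiv i f @^-1` (~` [set 0])).
      apply: opre; first exact/smooth_continuous/smooth_pderiv.
      by apply: closed_openC; exact: closed_eq.
    by apply/seteqP; split=> y /= /eqP.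
  + by split.
  + exact: smooth_onW.
  + move=> y [_ /= gy]; apply/eqP => /rowP/(_ i); rewrite !mxE.
    rewrite (pderivB i (smooth_cst t) sf) pderiv_cst /= sub0r => /eqP.
    by rewrite oppr_eq0 (negbTE gy).
  + apply/seteqP; split=> y.
      by move=> [[Uy tf] [_ gy]]; split => //=; rewrite subr_lt0.
    by move=> [/= tf [Uy gy]]; split => //; split=> //; rewrite /= -subr_lt0.
- split; last exact: subset_trans KO.
  exact: subclosed_compact (@closed_closure _ _) cK EK.
Qed.

End superlevel.

(** * Selection of a regular level with small boundary *)

Section good_level.
Context {R : realType} {n : nat}.
Local Notation N := n.+1.

Lemma hausdorff_premeasure_anti k (d1 d2 : R) (A : set 'rV[R]_N) : d1 <= d2 ->
  (hausdorff_premeasure k d2 A <= hausdorff_premeasure k d1 A)%E.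
Proof.
move=> d12; apply: ereal_inf_le_tmp => _ [F [AF Fd] <-]; exists F => //; split=> //.
by move=> i; apply: le_trans (Fd i) _; rewrite lee_fin.
Qed.

Lemma hausdorff_measure_ge0 k (A : set 'rV[R]_N) : (0 <= hausdorff_measure k A)%E.
Proof.
apply: (@le_trans _ _ (hausdorff_premeasure k 1 A)).
  apply: le_ereal_inf_tmp => _ [F _ <-]; apply: nneseries_ge0 => i _ _.
  exact: hausdorff_gauge_ge0.
by apply: ereal_sup_ubound; exists 1 => /=.
Qed.

(** Fatou applied to the functions of [coarea_cover] for the mesh bounds [1 / k.+1]: their lower
    limit dominates the Hausdorff measure. A measurable minorant [G] stands in for this measure as a
    function of the level, whose measurability is thereby never at issue. *)
Lemma coarea_inequality (f : 'rV[R]_N -> R) (K U : set 'rV[R]_N) (L : R)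
    (J : set (measurableTypeR R)) (G : measurableTypeR R -> \bar R) :
  smooth_on setT f -> compact K -> open U -> K `<=` U ->
  (forall x i, U x -> - L <= x ord0 i < L) -> 0 < L ->
  measurable J -> measurable_fun J G -> (forall t, J t -> (0 <= G t)%E) ->
  (forall t, J t -> exists A : set 'rV[R]_N, [/\ A `<=` K, forall x, A x -> f x = t &
    (G t <= hausdorff_measure n A)%E]) ->
  (\int[lebesgue_measure]_(t in J) G t <=
    (@coarea_const R n)%:E * \int[lebesgue_rV N]_(x in U) (grad1 f x)%:E)%E.
Proof.
move=> sf cK oU KU UL L0 mJ mG G0 GH.
have [g gP] := choice (fun k : nat => @coarea_cover R n f K U L k.+1%:R^-1
  sf cK oU KU UL L0 (ltac:(by rewrite invr_gt0))).
have mg k : measurable_fun setT (g k) by have [] := gP k.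
have g0 k t : (0 <= g k t)%E by have [_ /(_ t)] := gP k.
have gA k t A : A `<=` K -> (forall x, A x -> f x = t) ->
  (hausdorff_premeasure n k.+1%:R^-1 A <= g k t)%E by have [_ _ H _] := gP k; exact: H.
have gI k : (\int[lebesgue_measure]_t g k t <= (@coarea_const R n)%:E *
      (\int[lebesgue_rV N]_(x in U) (grad1 f x)%:E + k.+1%:R^-1%:E))%E.
  by have [] := gP k.
have small (d : R) : 0 < d -> exists k0, forall k, (k0 <= k)%N -> k.+1%:R^-1 <= d.
  move=> d0; have := @near_infty_natSinv_lt R (PosNum d0); case=> k0 _ k0P.
  by exists k0 => k k0k; apply/ltW/k0P.
have Gg t : J t -> (G t <= limn_einf (g ^~ t))%E.
  move=> Jt; have [A [AK At GA]] := GH t Jt; apply: (le_trans GA).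
  apply: ge_ereal_sup => _ [d /= d0 <-]; have [k0 k0P] := small d d0.
  apply: (limn_einf_ge (k0 := k0)) => k /k0P kd.
  exact: le_trans (hausdorff_premeasure_anti n A kd) (gA k t A AK At).
apply: (@le_trans _ _ (\int[lebesgue_measure]_(t in J) limn_einf (g ^~ t))%E).
  apply: ge0_le_integral => //.
  apply: measurable_funS (_ : measurable_fun setT _) => //.
  rewrite (_ : (fun _ => _) = -%E \o (fun t => limn_esup (fun k => - g k t)%E)).
    apply: measurableT_comp => //; apply: measurable_fun_limn_esup => k.
    exact: measurableT_comp.
  by apply/funext => t.
apply: (le_trans (fatou _ _ _ _)) => //.
  by move=> k; exact: measurable_funS (mg k).
have C0 := @coarea_const_gt0 R n.
have I0 : (0 <= \int[lebesgue_rV N]_(x in U) (grad1 f x)%:E)%E.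
  by apply: integral_ge0 => x _; rewrite lee_fin grad1_ge0.
apply/lee_addgt0Pr => d d0.
have d'0 : 0 < d / @coarea_const R n by rewrite divr_gt0.
have [k1 k1P] := small _ d'0.
apply: limn_einf_le => k0; exists (maxn k0 k1); first exact: leq_maxl.
apply: (@le_trans _ _ (\int[lebesgue_measure]_t g (maxn k0 k1) t)%E).
  by apply: ge0_subset_integral.
apply: (le_trans (gI _)).
rewrite ge0_muleDr//.
rewrite leeD2l// -EFinM lee_fin mulrC -ler_pdivlMr//; apply: k1P.
exact: leq_maxr.
Qed.

(** An averaging argument: the critical pairs form a set of measure at most [eps * e ^+ N / 2], so
    its sections over the cube of side [e] and volume [e ^+ N] cannot all exceed [eps]. The choice
    of [e] gives [N%:R * e * (1 + L) = eps], which serves both bounds on [a]. *)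
Lemma regular_tilt (w : 'rV[R]_N -> R) (L eps : R) :
  smooth_on setT w -> 0 < L -> 0 < eps ->
  exists (a : 'rV[R]_N) (bad : set (measurableTypeR R)),
    [/\ \sum_i `|a ord0 i| <= eps, (\sum_i `|a ord0 i|) * L <= eps,
      measurable bad, (lebesgue_measure bad <= eps%:E)%E &
      forall (x : 'rV[R]_N) t, (forall i, - L <= x ord0 i < L) -> ~ bad t ->
        w x - dot a x = t -> grad w x != a].
Proof.
move=> sw L0 eps0.
have L10 : 0 < 1 + L by rewrite addr_gt0.
pose e := eps / (N%:R * (1 + L)); have e0 : 0 < e by rewrite divr_gt0// mulr_gt0.
have en0 : 0 < e ^+ N by rewrite exprn_gt0.
have eta0 : 0 < eps * e ^+ N / 2 by rewrite divr_gt0// mulr_gt0.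
have [S [mS muS SP]] := critical_pairs_small sw L0 eta0.
have [a [ca bada]] : exists a : 'rV[R]_N, cube 0 e a /\
    (lebesgue_measure (xsection S a) <= eps%:E)%E.
  apply: contrapT => /forallNP H.
  have : (\int[lebesgue_rV N]_(a in cube 0 e) (cst eps%:E) a <=
          (lebesgue_rV N \x lebesgue_measure) S)%E.
    apply: (@le_trans _ _ (\int[lebesgue_rV N]_(a in cube 0 e)
        (lebesgue_measure \o xsection S) a)%E).
      apply: ge0_le_integral => //.
      - exact: measurable_cube.
      - by move=> a _; rewrite lee_fin ltW.
      - apply: measurable_funS (measurable_fun_xsection _ mS) => //.
      - move=> a ca; rewrite leNgt; apply/negP => lt_eps.
        by apply: (H a); split => //; exact: ltW.
    apply: ge0_subset_integral => //; first exact: measurable_cube.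
    exact: measurable_fun_xsection.
  rewrite integral_cst; last exact: measurable_cube.
  rewrite [X in (_ * X)%E](lebesgue_cube (n := N) _ (ltW e0)) => h.
  have := le_trans h muS; rewrite -EFinM lee_fin.
  have : 0 < eps * e ^+ N by rewrite mulr_gt0.
  by move: (_ * _) => b; lra.
have ai i : 0 <= a ord0 i < e by have := ca i; rewrite mxE add0r.
have suma : \sum_i `|a ord0 i| <= N%:R * e.
  apply: (@le_trans _ _ (\sum_(i < N) e)); last by rewrite sumr_const card_ord mulr_natl.
  by apply: ler_sum => i _; have /andP[a0 ae] := ai i; rewrite ger0_norm// ltW.
have NeL : N%:R * e * (1 + L) = eps.
  by rewrite /e; field; rewrite gt_eqF//= addrC natr1 pnatr_eq0.
have Ne0 : 0 <= N%:R * e by rewrite mulr_ge0// ltW.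
exists a, (xsection S a); split => //.
- apply: (le_trans suma); rewrite -NeL ler_peMr//; lra.
- apply: (@le_trans _ _ (N%:R * e * L)); first by rewrite ler_wpM2r// ltW.
  by rewrite -NeL ler_wpM2l//; lra.
- exact: measurable_xsection.
- move=> x t xL nbt wt; apply/eqP => ga; apply: nbt.
  by rewrite xsectionE -wt -ga; exact: SP.
Qed.

(* [A * beta - alpha] is the room left for the tilt and for the bad levels.
   If no level worked, integrating the failure over the remaining levels would
   contradict [coarea_inequality]. *)
Lemma good_level (w : 'rV[R]_N -> R) (U Omega : set 'rV[R]_N)
    (L T A alpha beta : R) :
  smooth_on setT w -> open U -> (forall x i, U x -> - L <= x ord0 i < L) ->
  0 < L -> (forall x, closure U x -> 0 < w x -> U x /\ Omega x) ->
  (forall x, U x -> 0 <= w x) -> 0 < T -> 0 < A ->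
  (\int[lebesgue_rV N]_(x in U) (grad1 w x)%:E <= alpha%:E)%E ->
  (beta%:E <= \int[lebesgue_rV N]_(x in U) (Num.min (w x) T)%:E)%E ->
  alpha < A * beta ->
  exists (E : set 'rV[R]_N) (t : R), [/\ [/\ E !=set0, open E, smooth_boundary E &
      compactly_contained E Omega], 0 < t < T, E `<=` U,
    (forall x, U x -> t < w x -> E x) &
    (hausdorff_measure n (boundary E) <=
       (@coarea_const R n * A)%:E * lebesgue_rV N E)%E].
Proof.
move=> sw oU UL L0 UO w0 T0 A0 wI wB AB.
have mU : measurable U by exact: open_measurable_rV.
have C0 := @coarea_const_gt0 R n.
have [u u0 uE] : exists2 u : R, 0 <= u & lebesgue_rV N U = u%:E.
  have : (lebesgue_rV N U <= ((2 * L) ^+ N)%:E)%E.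
    rewrite -(@lebesgue_cube _ N (const_mx (- L))); last by rewrite mulr_ge0// ltW.
    apply: (@le_measure _ _ _ (lebesgue_rV N)); rewrite ?inE//; first exact: measurable_cube.
    move=> x Ux i; rewrite mxE; have := UL x i Ux.
    by move: (x ord0 i) => a; lra.
  move=> /le_lt_trans/(_ (ltry _)) Uoo; exists (fine (lebesgue_rV N U)).
    by rewrite fine_ge0.
  by rewrite fineK// ge0_fin_numE.
have Icst (c : R) : (\int[lebesgue_rV N]_(x in U) c%:E = (c * u)%:E)%E.
  by rewrite integral_cst// [X in (_ * X)%E]uE -EFinM.
(* With [u] the volume of [U], the tilt adds at most [eps * u] to the integral of the gradient, and
   the discarded levels remove at most [5 * eps * u] from the mass, which counts [A] times. The
   summand 2 makes the final contradiction strict. *)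
pose D := 2 + u + 5 * A * u.
have Au0 : 0 <= A * u by rewrite mulr_ge0// ltW.
have D0 : 0 < D by rewrite /D; lra.
pose eps := Num.min (T / 5) ((A * beta - alpha) / D).
have eps0 : 0 < eps by rewrite lt_min !divr_gt0// subr_gt0.
have epsT : 5 * eps <= T by rewrite mulrC -ler_pdivlMr// ge_min lexx.
have epsD : eps * D <= A * beta - alpha by rewrite -ler_pdivlMr// ge_min lexx orbT.
have [a [bad [sa saL mbad bad_eps reg]]] := regular_tilt sw L0 eps0.
pose f x := w x - dot a x.
have sf : smooth_on setT f by apply: smoothB => //; exact: smooth_dot.
have mf : measurable_fun setT f.
  by apply: continuous_measurable_rV; exact: smooth_continuous.
have pf i x : pderiv i f x = pderiv i w x - a ord0 i.
  by rewrite (pderivB i sw (@smooth_dot _ _ a)) /= pderiv_dot.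
have clUL x i : closure U x -> `|x ord0 i| <= L.
  have cl : closed [set x : 'rV[R]_N | forall i, - L <= x ord0 i <= L].
    apply: compact_closed; first exact: norm_hausdorff.
    exact: compact_box.
  move=> Ux; suff : [set x : 'rV[R]_N | forall i, - L <= x ord0 i <= L] x.
    by move=> /(_ i); rewrite ler_norml.
  rewrite ((closure_id _).1 cl); apply: closureS Ux => y Uy j.
  by have /andP[-> /ltW ->] := UL y j Uy.
have dot_eps x : closure U x -> `|dot a x| <= eps.
  move=> Ux; apply: (le_trans (ler_norm_sum _ _ _)); apply: le_trans saL.
  by rewrite mulr_suml; apply: ler_sum => i _; rewrite normrM ler_wpM2l// clUL.
(* The tilt changes [w] by at most [eps] on [closure U], so [K] contains all points of [closure U]
   where [f] reaches a level above [2 * eps]. *)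
pose K := closure U `&` [set x | eps <= w x].
have clw : closed [set x | eps <= w x].
  rewrite (_ : mkset _ = w @^-1` `[eps, +oo[).
    by apply: closed_comp; [move=> y _; exact: smooth_continuous|exact: interval_closed].
  by apply/seteqP; split=> y; rewrite /= in_itv/= andbT.
have cK : compact K.
  apply: (subclosed_compact _ (@compact_box R N L)).
    by apply: closedI => //; exact: closed_closure.
  by move=> x [Ux _] i; rewrite -ler_norml clUL.
have KUO x : K x -> U x /\ Omega x.
  by move=> [Ux /= wx]; apply: UO => //; exact: lt_le_trans wx.
pose J : set (measurableTypeR R) := `]2 * eps, T - 2 * eps[%classic `\` bad.
have mJ : measurable J by apply: measurableD => //; exact: measurable_itv.
pose E t := U `&` [set x | t < f x].
have EP t : J t -> [/\ open (E t), smooth_boundary (E t),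
    compactly_contained (E t) Omega, boundary (E t) `<=` K &
    forall x, boundary (E t) x -> f x = t].
  move=> [/=]; rewrite in_itv /= => /andP[t1 t2] nbt.
  apply: superlevel_admissible => //.
  - by move=> x /KUO[].
  - by move=> x /KUO[].
  - move=> x Ux tx; split => //=; have := dot_eps x Ux; rewrite ler_norml.
    by move: tx; rewrite /f; move: (w x) (dot a x) => b c; lra.
  - move=> x Ux fxt; have := reg x t (fun i => UL x i Ux) nbt fxt.
    apply: contra_neq => /rowP g0; apply/rowP => i; have := g0 i.
    by rewrite !mxE pf => /eqP; rewrite subr_eq0 => /eqP.
apply: contrapT => NE.
have H t : J t -> ((@coarea_const R n * A)%:E * lebesgue_rV N (E t) <=
    hausdorff_measure n (boundary (E t)))%E.
  move=> Jt; have [oE sE cE bK bt] := EP t Jt.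
  have [E0|/set0P E0] := eqVneq (E t) set0.
    by rewrite E0 measure0 mule0 hausdorff_measure_ge0.
  rewrite leNgt; apply/negP => /ltW HE; apply: NE.
  exists (E t), (t + eps); move: Jt => [/=]; rewrite in_itv /= => /andP[t1 t2] _.
  split => //.
  - by apply/andP; split; lra.
  - by move=> x [].
  - move=> x Ux xt; split => //=; have := dot_eps x (subset_closure Ux).
    by rewrite ler_norml; move: xt; rewrite /f; move: (w x) (dot a x) => b c; lra.
have mE : measurable_fun J (fun t => lebesgue_rV N (E t)).
  by apply: measurable_funS (measurable_superlevel mU mf).
have I1 : (\int[lebesgue_rV N]_(x in U) (grad1 f x)%:E <= (alpha + eps * u)%:E)%E.
  apply: (@le_trans _ _ (\int[lebesgue_rV N]_(x in U) ((grad1 w x)%:E + eps%:E))%E).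
    apply: ge0_le_integral => //.
    - by move=> x _; rewrite lee_fin grad1_ge0.
    - by apply/measurable_EFinP; apply: measurable_funS (measurable_grad1 sf).
    - apply: emeasurable_funD => //.
      by apply/measurable_EFinP; apply: measurable_funS (measurable_grad1 sw).
    - move=> x _; rewrite -EFinD lee_fin.
      apply: (@le_trans _ _ (grad1 w x + \sum_i `|a ord0 i|)); last by rewrite lerD2l.
      rewrite /grad1 -big_split/=; apply: ler_sum => i _; rewrite pf.
      exact: ler_normB.
  rewrite ge0_integralD//; last 3 first.
  - by move=> x _; rewrite lee_fin grad1_ge0.
  - by apply/measurable_EFinP; apply: measurable_funS (measurable_grad1 sw).
  - by move=> x _; rewrite lee_fin ltW.
  by rewrite Icst EFinD leeD2r.
have I2 : (A%:E * \int[lebesgue_measure]_(t in J) lebesgue_rV N (E t) <=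
    (alpha + eps * u)%:E)%E.
  have h : ((@coarea_const R n * A)%:E * \int[lebesgue_measure]_(t in J) lebesgue_rV N (E t) <=
    (@coarea_const R n)%:E * (alpha + eps * u)%:E)%E.
    apply: le_trans (lee_wpmul2l _ I1); last by rewrite lee_fin ltW.
    rewrite -ge0_integralZl_EFin//; last by rewrite mulr_ge0// ltW.
    apply: (coarea_inequality sf cK oU _ UL L0 mJ).
    - by move=> x /KUO[].
    - by apply: measurable_funeM.
    - by move=> t _; rewrite mule_ge0// lee_fin mulr_ge0// ltW.
    - move=> t Jt; exists (boundary (E t)).
      by have [_ _ _ bK bt] := EP t Jt; split => //; exact: H.
  by move: h; rewrite EFinM -muleA lee_pmul2l// lte_fin.
have I3 : (beta%:E <= \int[lebesgue_measure]_(t in J) lebesgue_rV N (E t) + (5 * eps * u)%:E)%E.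
  rewrite tonelli_superlevel//.
  have mlt x : measurable (J `&` [set t : measurableTypeR R | t < f x]).
    apply: measurableI => //; rewrite (_ : mkset _ = `]-oo, f x[%classic).
      exact: measurable_itv.
    by apply/seteqP; split=> t; rewrite /= in_itv.
  have mlen : measurable_fun U (fun x => lebesgue_measure (J `&` [set t | t < f x]%R)).
    exact: measurable_funS (measurable_sublength mJ mf).
  apply: (le_trans wB).
  apply: (@le_trans _ _ (\int[lebesgue_rV N]_(x in U)
      (lebesgue_measure (J `&` [set t | t < f x]%R) + (5 * eps)%:E))%E).
    apply: ge0_le_integral => //.
    - by move=> x Ux; rewrite lee_fin le_min w0// ltW.
    - apply/measurable_EFinP; apply: measurable_funS (_ : measurable_fun setT _) => //.
      apply: measurable_minr => //.
      by apply: continuous_measurable_rV; exact: smooth_continuous.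
    - exact: emeasurable_funD.
    - move=> x Ux.
      (* The levels of [J] below [f x] fill the interval from [2 * eps] to [m] up to bad levels. Its
         ends and the tilt lose at most [4 * eps] against [Num.min (w x) T], the bad levels at most
         [eps]. *)
      pose m := Num.min (f x) (T - 2 * eps).
      pose Im : set (measurableTypeR R) := `]2 * eps, m[%classic.
      have : (lebesgue_measure Im <=
          lebesgue_measure (J `&` [set t | t < f x]%R) + eps%:E)%E.
        apply: (@le_trans _ _ (lebesgue_measure
            ((J `&` [set t | t < f x]%R) `|` bad))).
          apply: (@le_measure _ _ _ lebesgue_measure); rewrite ?inE.
          + exact: measurable_itv.
          + by apply: measurableU.
          + move=> t; rewrite /Im /= in_itv /= => /andP[t1]; rewrite lt_min => /andP[t2 t3].
            have [bt|nbt] := pselect (bad t); [by right|left].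
            by split => //; split => //=; rewrite in_itv /= t1 t3.
        apply: (le_trans (measureU2 _ _ _)) => //.
        by rewrite leeD2l.
      move=> h; apply: (@le_trans _ _ ((m - 2 * eps)%:E + (4 * eps)%:E)%E).
        rewrite -EFinD lee_fin /m; have := dot_eps x (subset_closure Ux).
        rewrite ler_norml /f; move: (w x) (dot a x) => b c.
        by rewrite /Num.min; do 2 case: ifP; lra.
      apply: (@le_trans _ _ (lebesgue_measure (J `&` [set t | t < f x]%R) +
          eps%:E + (4 * eps)%:E)%E).
        apply: leeD => //; apply: le_trans h.
        rewrite /Im lebesgue_measure_itv/= lte_fin; case: ifPn => [|]; first by rewrite EFinB.
        by rewrite -leNgt lee_fin; lra.
      rewrite -addeA -EFinD leeD2l// lee_fin; lra.
  rewrite ge0_integralD//; last by move=> x _; rewrite lee_fin mulr_ge0// ltW.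
  by rewrite Icst.
have I0 : (0 <= \int[lebesgue_measure]_(t in J) lebesgue_rV N (E t))%E.
  by apply: integral_ge0.
move: I0 I2 I3; case: (integral _ _ _) => [i | |].
- rewrite -EFinM -EFinD !lee_fin => i0 I2 I3.
  have : A * beta <= A * i + A * (5 * eps * u) by rewrite -mulrDr ler_pM2l.
  move: epsD; rewrite /D; lra.
- by rewrite mulry gtr0_sg// mul1e leye_eq.
- by rewrite leeNy_eq.
Qed.

End good_level.

(** * A Poincare inequality for small supports *)

Section small_support.
Context {R : realType} {n : nat}.
Local Notation N := n.+1.
Implicit Types (v : 'rV[R]_N -> R).

(** The translation is cut into [m] equal steps [z]. For large [m] a single step is controlled by
    the gradient at the starting point up to a small error, and by translation invariance all steps
    have the same integral, so no integration along segments is needed. *)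
Lemma translation_estimate v (L s : R) (y : 'rV[R]_N) :
  smooth_on setT v -> 0 < L -> (forall x i, v x != 0 -> `|x ord0 i| <= L) ->
  0 < s -> (forall i, 0 <= y ord0 i <= s) ->
  (\int[lebesgue_rV N]_x (`|v (x + y)%R - v x|%R)%:E <=
    s%:E * \int[lebesgue_rV N]_x (grad1 v x)%:E)%E.
Proof.
move=> sv L0 vL s0 ys.
have mv : measurable_fun setT v.
  by apply: continuous_measurable_rV; exact: smooth_continuous.
have mvz (z : 'rV[R]_N) : measurable_fun setT (fun x : 'rV[R]_N => v (x + z)).
  exact: (measurableT_comp mv (measurable_shift_rV z)).
have mphi (z : 'rV[R]_N) : measurable_fun setT (fun x : 'rV[R]_N => (`|v (x + z) - v x|)%:E).
  apply/measurable_EFinP; apply: measurableT_comp => //.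
  exact: measurable_funB.
have mg : measurable_fun setT (fun x => (grad1 v x)%:E).
  by apply/measurable_EFinP; exact: measurable_grad1.
have I0 : (0 <= \int[lebesgue_rV N]_x (grad1 v x)%:E)%E.
  by apply: integral_ge0 => x _; rewrite lee_fin grad1_ge0.
apply/lee_addgt0Pr => d d0.
have L20 : 0 < 2 * L + 2 by rewrite addr_gt0// mulr_gt0.
pose V := (2 * L + 2) ^+ N; have V0 : 0 < V by rewrite exprn_gt0.
(* The errors of the [m] steps add up to [s * N%:R * e * V = d]. Here [V] is the volume of the box
   [B] with half-side [L + 1], which contains the support of the difference once the coordinates of
   [z] are less than 1. *)
pose e := d / (s * N%:R * V).
have sNV0 : 0 < s * N%:R * V by apply: mulr_gt0 => //; apply: mulr_gt0.
have e0 : 0 < e by rewrite divr_gt0.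
have [d1 d10 d1P] := compact_modulus (g := fun i => pderiv i v)
  (@compact_box R N (L + 1)) (fun i => smooth_continuous (smooth_pderiv i sv)) e0.
have dm0 : 0 < Num.min d1 1 by rewrite lt_min d10 ltr01.
pose m := (Num.truncn (s / Num.min d1 1)).+1.
have m0 : (0 : R) < m%:R by exact: ltr0Sn.
have [sd1 sd2] : s / m%:R < d1 /\ s / m%:R < 1.
  have : s / m%:R < Num.min d1 1.
    rewrite ltr_pdivrMr// [Num.min d1 1 * _]mulrC -ltr_pdivrMr//.
    by have /truncn_itv/andP[] : 0 <= s / Num.min d1 1 by rewrite divr_ge0// ltW.
  by rewrite lt_min => /andP[].
pose z := m%:R^-1 *: y.
have zi i : 0 <= z ord0 i <= s / m%:R.
  have /andP[y0 y1] := ys i; rewrite mxE mulrC; apply/andP; split.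
    by rewrite divr_ge0// ltW.
  by rewrite ler_pM2r// invr_gt0.
pose B : set 'rV[R]_N := cube (const_mx (- (L + 1))) (2 * L + 2).
have phiP x : `|v (x + z) - v x| <= s / m%:R * (grad1 v x + N%:R * e * \1_B x).
  have rhs0 : 0 <= s / m%:R * (grad1 v x + N%:R * e * \1_B x).
    apply: mulr_ge0; first by rewrite divr_ge0// ltW.
    apply: addr_ge0; first exact: grad1_ge0.
    by rewrite indicE; apply: mulr_ge0 => //; apply: mulr_ge0 => //; exact: ltW.
  have xB : v x != 0 \/ v (x + z) != 0 -> forall i, - (L + 1) < x ord0 i < L + 1.
    have near i : `|z ord0 i| < 1.
      by have /andP[h1 h2] := zi i; rewrite ger0_norm//; exact: le_lt_trans sd2.
    case=> /vL h i; have := h i; have := near i; rewrite ?mxE ler_norml ltr_norml;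
      move: (x ord0 i) (z ord0 i) => a b; lra.
  have [[vx vxz]|] := pselect (v x = 0 /\ v (x + z) = 0).
    by rewrite vx vxz subrr normr0 in rhs0 *.
  move=> nvv; have {}xB : forall i, - (L + 1) < x ord0 i < L + 1.
    apply: xB; have [vx|] := eqVneq (v x) 0; last by left.
    by right; apply/eqP => vxz; exact: nvv.
  have Bx : B x.
    by move=> i; rewrite mxE; have := xB i; move: (x ord0 i) => a; lra.
  rewrite indicE mem_set// mulr1.
  apply: le_trans (coord_increments (M := fun i => `|pderiv i v x| + e) sv _) _.
    move=> i t xt.
    have xbox j : - (L + 1) <= x ord0 j <= L + 1.
      by have /andP[/ltW -> /ltW ->] := xB j.
    have xtd j : `|x ord0 j - t ord0 j| < d1.
      have := xt j; have := zi j; rewrite ge_min le_max !mxE ltr_norml; move: sd1.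
      by move: (s / m%:R) (x ord0 j) (_ * _) (t ord0 j) => a b c c'; lra.
    have := ltW (d1P x t xbox xtd i).
    have := ler_normB (pderiv i v x) (pderiv i v x - pderiv i v t).
    rewrite opprB addrC subrK; move: (`|_|) (`|_|) (`|_|) => a b c; lra.
  rewrite (_ : N%:R * e = \sum_(i < N) e); last by rewrite sumr_const card_ord mulr_natl.
  rewrite /grad1 -big_split/= mulr_sumr; apply: ler_sum => i _.
  rewrite mulrC ler_wpM2r//; first by rewrite addr_ge0// ltW.
  rewrite mxE addrAC subrr add0r; have /andP[h1 h2] := zi i.
  by rewrite ger0_norm.
have phiI : (\int[lebesgue_rV N]_x (`|v (x + z)%R - v x|%R)%:E <=
    (s / m%:R)%:E * (\int[lebesgue_rV N]_x (grad1 v x)%:E + (N%:R * e * V)%:E))%E.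
  have mB : measurable B by exact: measurable_cube.
  have m1B : measurable_fun setT (fun x => (\1_B x : R)%:E).
    by apply/measurable_EFinP; exact: measurable_indic.
  apply: (@le_trans _ _ (\int[lebesgue_rV N]_x
      ((s / m%:R)%:E * ((grad1 v x)%:E + (N%:R * e)%:E * (\1_B x)%:E)))%E).
    apply: ge0_le_integral => //.
    - by apply: measurable_funeM; apply: emeasurable_funD => //; apply: measurable_funeM.
    - by move=> x _; rewrite -[leRHS]/(s / m%:R * (grad1 v x + N%:R * e * \1_B x))%:E lee_fin.
  have Ne0 : 0 <= N%:R * e by rewrite mulr_ge0// ltW.
  have ge1 x : (0 <= (N%:R * e)%:E * (\1_B x)%:E)%E.
    by rewrite -EFinM lee_fin mulr_ge0// indicE.
  rewrite ge0_integralZl_EFin//; last 3 first.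
  - by move=> x _; rewrite adde_ge0// lee_fin grad1_ge0.
  - by apply: emeasurable_funD => //; apply: measurable_funeM.
  - by rewrite divr_ge0// ltW.
  rewrite ge0_integralD//; last 2 first.
  - by move=> x _; rewrite lee_fin grad1_ge0.
  - by apply: measurable_funeM.
  rewrite ge0_integralZl_EFin//.
  rewrite integral_indic// setIT.
  by rewrite [X in ((N%:R * e)%:E * X)%E](lebesgue_cube (n := N) _ (ltW L20)) -EFinM.
have tele x : (`|v (x + y) - v x|%:E <=
    \sum_(k < m) `|v ((x + z *+ k) + z)%R - v (x + z *+ k)%R|%:E)%E.
  have -> : v (x + y) - v x = \sum_(k < m) (v ((x + z *+ k) + z) - v (x + z *+ k)).
    have zm : z *+ m = y by rewrite -scaler_nat scalerA divff ?scale1r ?gt_eqF.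
    transitivity (\sum_(0 <= k < m) (v (x + z *+ k.+1) - v (x + z *+ k))).
      by rewrite telescope_sumr// zm mulr0n addr0.
    by rewrite big_mkord; apply: eq_bigr => k _; rewrite mulrSr addrA.
  by rewrite sumEFin lee_fin; exact: ler_norm_sum.
apply: (@le_trans _ _ (\int[lebesgue_rV N]_x
    \sum_(k < m) `|v ((x + z *+ k) + z)%R - v (x + z *+ k)%R|%:E)%E).
  apply: ge0_le_integral => //; apply: emeasurable_sum => k.
  exact: (measurableT_comp (mphi z) (measurable_shift_rV _)).
rewrite ge0_integral_sum//; last first.
  by move=> k; exact: (measurableT_comp (mphi z) (measurable_shift_rV _)).
rewrite (eq_bigr (fun=> \int[lebesgue_rV N]_x (`|v (x + z)%R - v x|%R)%:E)%E); last first.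
  move=> k _.
  exact: (@integral_shift_rV _ _ _ (fun x => (`|v (x + z) - v x|)%:E)).
apply: (@le_trans _ _ (\sum_(k < m) ((s / m%:R)%:E *
    (\int[lebesgue_rV N]_x (grad1 v x)%:E + (N%:R * e * V)%:E)))%E).
  exact: lee_sum.
rewrite -ge0_sume_distrl; last by move=> k _; rewrite lee_fin divr_ge0// ltW.
rewrite sumEFin sumr_const card_ord -[s / m%:R *+ m]mulr_natl.
rewrite (_ : m%:R * (s / m%:R) = s); last by rewrite mulrC divfK// gt_eqF.
have NeV0 : 0 <= N%:R * e * V.
  by apply: mulr_ge0; [apply: mulr_ge0 => //|]; exact: ltW.
rewrite ge0_muleDr//; rewrite leeD2l// -EFinM lee_fin.
rewrite (_ : s * (N%:R * e * V) = e * (s * N%:R * V)).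
  by rewrite /e divfK// gt_eqF.
by move: (N%:R : R) => a; ring.
Qed.

Lemma measurable_add_rV :
  measurable_fun setT (fun p : 'rV[R]_N * 'rV[R]_N => p.1 + p.2).
Proof.
apply: measurable_fun_rV => i.
rewrite (_ : _ \o _ = (fun p => rV_coord i p.1 + rV_coord i p.2)); last first.
  by apply/funext => p; rewrite /= /rV_coord mxE.
apply: measurable_funD; apply: (measurableT_comp (measurable_rV_coord i)).
  exact: measurable_fst.
exact: measurable_snd.
Qed.

(* Compares [v] at [x] with its values on the cube [x + [0, s[^N], half of
   which lies outside the superlevel set. *)
Lemma poincare_small v (L s t : R) :
  smooth_on setT v -> 0 < L -> (forall x i, v x != 0 -> `|x ord0 i| <= L) ->
  0 < s -> (lebesgue_rV N [set x | (t < v x)%R] <= (s ^+ N / 2)%:E)%E ->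
  (\int[lebesgue_rV N]_x (Num.max (v x - t) 0)%:E <=
    (2 * s)%:E * \int[lebesgue_rV N]_x (grad1 v x)%:E)%E.
Proof.
move=> sv L0 vL s0 small.
have mv : measurable_fun setT v.
  by apply: continuous_measurable_rV; exact: smooth_continuous.
pose Y : set 'rV[R]_N := cube 0 s.
have mY : measurable Y by exact: measurable_cube.
have m1Y : measurable_fun setT (\1_Y : 'rV[R]_N -> R) by exact: measurable_indic.
have lY : lebesgue_rV N Y = (s ^+ N)%:E by rewrite lebesgue_cube// ltW.
have sN0 : 0 < s ^+ N by rewrite exprn_gt0.
pose F (p : 'rV[R]_N * 'rV[R]_N) := (`|v (p.1 + p.2) - v p.1| * \1_Y p.2)%:E.
have mF : measurable_fun setT F.
  apply/measurable_EFinP; apply: measurable_funM.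
    apply: measurableT_comp => //; apply: measurable_funB.
      exact: (measurableT_comp mv measurable_add_rV).
    by apply: (measurableT_comp mv); exact: measurable_fst.
  by apply: (measurableT_comp m1Y); exact: measurable_snd.
have F0 p : (0 <= F p)%E by rewrite lee_fin mulr_ge0// indicE.
pose vt (x : 'rV[R]_N) : R := Num.max (v x - t) 0.
have vt0 x : 0 <= vt x by rewrite le_max lexx orbT.
have mvt : measurable_fun setT vt.
  by apply: measurable_maxr => //; apply: measurable_funB.
have mvtE : measurable_fun setT (EFin \o vt) by exact/measurable_EFinP.
have mYE : measurable_fun setT (EFin \o (\1_Y : 'rV[R]_N -> R)) by exact/measurable_EFinP.
have mS x : measurable [set y : 'rV[R]_N | t < v (x + y)].
  have h := measurableT_comp mv (measurable_shift_rV x).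
  rewrite (_ : mkset _ = setT `&` (v \o (fun y => y + x)) @^-1` `]t, +oo[%classic).
    by apply: h => //; exact: measurable_itv.
  rewrite setTI; apply/seteqP; split=> y; rewrite /= in_itv/= andbT [y + x]addrC//.
(* At least the volume [s ^+ N / 2] of [Y] consists of [y] with [v (x + y) <= t], and there the
   difference is at least [vt x]. *)
have lower x : ((s ^+ N / 2)%:E * (vt x)%:E <= \int[lebesgue_rV N]_y F (x, y))%E.
  pose S := [set y : 'rV[R]_N | t < v (x + y)].
  have lS : (lebesgue_rV N S <= (s ^+ N / 2)%:E)%E.
    rewrite (_ : S = (fun y => y + x) @^-1` [set x | t < v x]).
      rewrite lebesgue_rV_shift//.
      have := mS 0; rewrite (_ : mkset _ = [set x | t < v x])//.
      by apply/seteqP; split=> y /=; rewrite add0r.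
    by apply/seteqP; split=> y /=; rewrite [y + x]addrC.
  have mYS : measurable (Y `\` S) by apply: measurableD => //; exact: (mS x).
  have lYS : ((s ^+ N / 2)%:E <= lebesgue_rV N (Y `\` S))%E.
    have : ((s ^+ N)%:E <= lebesgue_rV N (Y `\` S) + (s ^+ N / 2)%:E)%E.
      rewrite -lY; apply: (@le_trans _ _ (lebesgue_rV N ((Y `\` S) `|` S))).
        apply: (@le_measure _ _ _ (lebesgue_rV N)); rewrite ?inE//.
          by apply: measurableU; [exact: mYS|exact: (mS x)].
        by move=> y Yy; have [Sy|nSy] := pselect (S y); [right|left].
      apply: (le_trans (measureU2 _ _ _)) => //; first exact: (mS x).
      exact: leeD2l.
    have := measure_ge0 (lebesgue_rV N) (Y `\` S).
    move: (lebesgue_rV N (Y `\` S)) => [b | | ] //.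
      rewrite -EFinD !lee_fin => _; lra.
    by move=> _ _; exact: leey.
  apply: (@le_trans _ _ (\int[lebesgue_rV N]_y ((vt x)%:E * (\1_(Y `\` S) y)%:E))%E).
    rewrite ge0_integralZl_EFin//; last by apply/measurable_EFinP; exact: measurable_indic.
    rewrite integral_indic// setIT muleC.
    by apply: lee_wpmul2l; rewrite ?lee_fin.
  apply: ge0_le_integral => //.
  - by move=> y _; rewrite -EFinM lee_fin mulr_ge0// indicE.
  - by apply: measurable_funeM; apply/measurable_EFinP; exact: measurable_indic.
  - exact: (measurableT_comp mF (measurable_pair1 x)).
  - move=> y _; rewrite -EFinM /F lee_fin /= !indicE in_setD.
    case: (boolP (y \in Y)) => /= Yy; last by rewrite !mulr0.
    case: (boolP (y \in S)) => /= Sy; first by rewrite mulr0 mulr1.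
    rewrite !mulr1 /vt ge_max normr_ge0 andbT.
    have {}Sy : v (x + y) <= t.
      by rewrite leNgt; apply/negP => h; move/negP: Sy; apply; rewrite inE.
    have := ler_norm (v x - v (x + y)); rewrite distrC.
    by move: Sy; move: (v (x + y)) (v x) (`|_|) => a b c; lra.
have upper y : (\int[lebesgue_rV N]_x F (x, y) <=
    (s%:E * \int[lebesgue_rV N]_x (grad1 v x)%:E) * (\1_Y y)%:E)%E.
  rewrite indicE; case: (boolP (y \in Y)) => Yy /=; last first.
    rewrite mule0 integral0_eq// => x _.
    by rewrite /F /= indicE (negbTE Yy) mulr0.
  rewrite mule1 (_ : (\int[_]_x _)%E = \int[lebesgue_rV N]_x (`|v (x + y)%R - v x|%R)%:E)%E.
    apply: (translation_estimate (y := y) sv L0 vL s0).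
    by move=> i; rewrite inE in Yy; have := Yy i; rewrite mxE add0r => /andP[-> /ltW ->].
  by apply: eq_integral => x _; rewrite /F /= indicE Yy mulr1.
have I0 : (0 <= \int[lebesgue_rV N]_x (grad1 v x)%:E)%E.
  by apply: integral_ge0 => x _; rewrite lee_fin grad1_ge0.
have h1 : ((s ^+ N / 2)%:E * \int[lebesgue_rV N]_x (vt x)%:E <=
    (s%:E * \int[lebesgue_rV N]_x (grad1 v x)%:E) * (s ^+ N)%:E)%E.
  have c0 : 0 <= s ^+ N / 2 by rewrite divr_ge0// ltW.
  have vtE0 (x : 'rV[R]_N) : setT x -> (0 <= (EFin \o vt) x)%E by rewrite lee_fin.
  rewrite -(ge0_integralZl_EFin (lebesgue_rV N) measurableT vtE0 mvtE c0)//.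
  apply: (@le_trans _ _ (\int[lebesgue_rV N]_x \int[lebesgue_rV N]_y F (x, y))%E).
    apply: ge0_le_integral => //.
    - by move=> x _; rewrite -EFinM lee_fin mulr_ge0// divr_ge0// ltW.
    - exact: measurable_funeM mvtE.
    - exact: measurable_fun_fubini_tonelli_F.
    - by move=> x _; exact: lower.
  apply: (@le_trans _ _ (\int[lebesgue_rV N]_y \int[lebesgue_rV N]_x F (x, y))%E).
    by rewrite le_eqVlt; apply/orP; left; apply/eqP; exact: fubini_tonelli.
  apply: (@le_trans _ _ (\int[lebesgue_rV N]_y
      ((s%:E * \int[lebesgue_rV N]_x (grad1 v x)%:E) * (\1_Y y)%:E))%E).
    apply: ge0_le_integral => //.
    - by move=> y _; apply: integral_ge0.
    - exact: measurable_fun_fubini_tonelli_G.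
    - exact: measurable_funeM mYE.
  rewrite ge0_integralZl//; last by rewrite mule_ge0// lee_fin ltW.
  rewrite integral_indic// setIT; apply: lee_wpmul2l.
    by rewrite mule_ge0// lee_fin ltW.
  by rewrite -lY.
have h2 : ((s ^+ N / 2)%:E * \int[lebesgue_rV N]_x (vt x)%:E <=
    (s ^+ N / 2)%:E * ((2 * s)%:E * \int[lebesgue_rV N]_x (grad1 v x)%:E))%E.
  apply: (le_trans h1); rewrite muleC !muleA -!EFinM.
  by rewrite (_ : s ^+ N * s = s ^+ N / 2 * (2 * s))//; field.
by move: h2; rewrite lee_pmul2l// lte_fin divr_gt0.
Qed.

End small_support.

(** * Localization *)

Section cutoff.
Context {R : realType} {n : nat}.
Local Notation N := n.+1.

(** The paraboloid [1 - |x - z|^2 / r^2], written with products to which [smoothM] applies. It is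
    symmetric in [x] and [z], which the averaging over [z] exploits. *)
Definition cutoff (z : 'rV[R]_N) (r : R) (x : 'rV[R]_N) : R :=
  1 - \sum_i (r^-1 * (x ord0 i - z ord0 i)) * (r^-1 * (x ord0 i - z ord0 i)).

Lemma smooth_affine (z : 'rV[R]_N) (r : R) (i : 'I_N) :
  smooth_on setT (fun x : 'rV[R]_N => r^-1 * (x ord0 i - z ord0 i)).
Proof.
apply: smoothZ; apply: smoothB; first exact: smooth_coord.
exact: smooth_cst.
Qed.

Lemma smooth_cutoff z r : smooth_on setT (cutoff z r).
Proof.
apply: smoothB; first exact: smooth_cst.
by apply: smooth_sum => i; apply: smoothM; exact: smooth_affine.
Qed.

Lemma pderiv_cutoff z r i x :
  pderiv i (cutoff z r) x = - (2 * r^-1 * (r^-1 * (x ord0 i - z ord0 i))).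
Proof.
have sM j : smooth_on setT (fun x : 'rV[R]_N =>
    (r^-1 * (x ord0 j - z ord0 j)) * (r^-1 * (x ord0 j - z ord0 j))).
  by apply: smoothM; exact: smooth_affine.
rewrite /cutoff (pderivB i (smooth_cst 1) (smooth_sum _ sM)) pderiv_cst /= sub0r.
congr (- _); rewrite pderiv_sum//.
have pa j : pderiv i (fun x : 'rV[R]_N => r^-1 * (x ord0 j - z ord0 j)) x =
    r^-1 * (i == j)%:R.
  rewrite pderivZ; last by apply: smoothB; [exact: smooth_coord|exact: smooth_cst].
  by rewrite (pderivB i (smooth_coord j) (smooth_cst _)) pderiv_coord pderiv_cst /= subr0.
rewrite (bigD1 i)//= big1 => [|j ji].
  rewrite (pderivM i (smooth_affine z r i) (smooth_affine z r i)) /= pa eqxx.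
  by rewrite mulr1 addr0; move: (r^-1) => a; ring.
rewrite (pderivM i (smooth_affine z r j) (smooth_affine z r j)) /= pa.
by rewrite eq_sym (negbTE ji) !mulr0 addr0.
Qed.

Lemma cutoff_le1 z r x : cutoff z r x <= 1.
Proof. by rewrite gerBl sumr_ge0// => i _; rewrite -expr2 sqr_ge0. Qed.

Lemma cutoff_gt0_near z (r : R) x : 0 < r -> 0 < cutoff z r x ->
  forall i, `|x ord0 i - z ord0 i| < r.
Proof.
move=> r0; rewrite subr_gt0 => b1 i.
have : (r^-1 * (x ord0 i - z ord0 i)) ^+ 2 < 1 ^+ 2.
  rewrite expr1n; apply: le_lt_trans b1; rewrite (bigD1 i)//= expr2 lerDl.
  by rewrite sumr_ge0// => j _; rewrite -expr2 sqr_ge0.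
rewrite -[X in X < _]real_normK ?num_real// ltr_sqr ?nnegrE// normrM gtr0_norm ?invr_gt0//.
by rewrite mulrC ltr_pdivrMr// mul1r.
Qed.

(** Each of the [N] squares is at most [(2N)^-2], hence at most [(2N)^-1], and together they use up
    at most one half. *)
Lemma cutoff_ge_half (z : 'rV[R]_N) (r : R) (x : 'rV[R]_N) : 0 < r ->
  (forall i, `|x ord0 i - z ord0 i| <= r / (2 * N%:R)) -> 1 / 2 <= cutoff z r x.
Proof.
move=> r0 xz; rewrite /cutoff.
have N0 : 0 < N%:R :> R by rewrite ltr0n.
have : \sum_i (r^-1 * (x ord0 i - z ord0 i)) * (r^-1 * (x ord0 i - z ord0 i))
    <= \sum_(i < N) ((2 * N%:R)^-1 : R).
  apply: ler_sum => i _; rewrite -expr2 -real_normK ?num_real//.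
  have h : `|r^-1 * (x ord0 i - z ord0 i)| <= (2 * N%:R)^-1.
    rewrite normrM gtr0_norm ?invr_gt0// mulrC ler_pdivrMr// mulrC.
    exact: xz.
  apply: (@le_trans _ _ ((2 * N%:R)^-1 ^+ 2)).
    by apply: lerXn2r; rewrite ?nnegrE// invr_ge0 mulr_ge0.
  rewrite expr2 ler_piMl// ?invr_ge0 ?mulr_ge0// invf_le1 ?mulr_gt0//.
  by rewrite -natrM ler1n.
rewrite sumr_const card_ord -[_ *+ N]mulr_natl invfM mulrCA divff ?gt_eqF//.
by rewrite mulr1; lra.
Qed.

Definition cutoff_set z r : set 'rV[R]_N := [set x | 0 < cutoff z r x].

Lemma open_cutoff_set z r : open (cutoff_set z r).
Proof.
rewrite (_ : cutoff_set z r = cutoff z r @^-1` `]0, +oo[).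
  apply: open_comp; last exact: interval_open.
  by move=> x _; apply: smooth_continuous; exact: smooth_cutoff.
by apply/seteqP; split=> x; rewrite /= in_itv/= andbT.
Qed.

Lemma closure_cutoff_set z r x : closure (cutoff_set z r) x -> 0 <= cutoff z r x.
Proof.
have cl : closed [set x | 0 <= cutoff z r x].
  rewrite (_ : mkset _ = cutoff z r @^-1` `[0, +oo[).
    apply: closed_comp; last exact: interval_closed.
    by move=> y _; apply: smooth_continuous; exact: smooth_cutoff.
  by apply/seteqP; split=> y; rewrite /= in_itv/= andbT.
move=> Ex; suff : [set y | 0 <= cutoff z r y] x by [].
by rewrite ((closure_id _).1 cl); apply: closureS Ex => y /ltW.
Qed.

Lemma cutoff_set_cube z (r : R) : 0 < r ->
  cutoff_set z r `<=` cube (z - const_mx r) (2 * r).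
Proof.
move=> r0 x bx i; have := cutoff_gt0_near r0 bx i; rewrite !mxE ltr_norml.
by move: (x ord0 i) (z ord0 i) => a b; lra.
Qed.

Lemma lebesgue_cutoff_set z (r : R) : 0 < r ->
  (lebesgue_rV N (cutoff_set z r) <= ((2 * r) ^+ N)%:E)%E.
Proof.
move=> r0; rewrite -(@lebesgue_cube _ N (z - const_mx r)); last by rewrite mulr_ge0// ltW.
apply: (@le_measure _ _ _ (lebesgue_rV N)); rewrite ?inE//.
- by apply: open_measurable_rV; exact: open_cutoff_set.
- exact: measurable_cube.
- exact: cutoff_set_cube.
Qed.

End cutoff.

Section good_sets.
Context {R : realType} {n : nat}.
Local Notation N := n.+1.
Implicit Types (v : 'rV[R]_N -> R) (Omega E : set 'rV[R]_N).

Definition admissible Omega E := [/\ E !=set0, open E, smooth_boundary E &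
  compactly_contained E Omega].

Lemma bounded_of_support v (L : R) : smooth_on setT v ->
  (forall x i, v x != 0 -> `|x ord0 i| <= L) ->
  exists2 M : R, 0 < M & forall x, v x <= M.
Proof.
move=> sv vL.
have [M M0 MP] := compact_fun_bounded (g := fun _ : 'I_1 => v)
  (@compact_box R N L) (fun _ => smooth_continuous sv).
exists M => // x; have [->|vx] := eqVneq (v x) 0; first exact: ltW.
apply: le_trans (ler_norm _) _; apply: (MP ord0) => i.
by rewrite -ler_norml; exact: vL.
Qed.

(** [(4 * N%:R) ^+ N] is the ratio of the volumes of two cubes, of side [2 * r] around the ball of
    the cutoff and of side [r / (2 * N%:R)] where the cutoff is at least one half; [1 + 2 * N%:R]
    comes from the gradient of the product with the cutoff. Of the 4, one factor 2 undoes that half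
    and the other makes the inequality strict. *)
Definition localization_const : R := 4 * (4 * N%:R) ^+ N * (1 + 2 * N%:R).

Lemma localization_const_gt0 : 0 < localization_const.
Proof.
have N0 : 0 < N%:R :> R by rewrite ltr0n.
apply: mulr_gt0; last by lra.
by apply: mulr_gt0 => //; rewrite exprn_gt0// mulr_gt0.
Qed.

Lemma measurable_cutoff (r : R) : measurable_fun setT
  (fun p : 'rV[R]_N * 'rV[R]_N => cutoff p.2 r p.1).
Proof.
have m i : measurable_fun setT (fun p : 'rV[R]_N * 'rV[R]_N =>
    r^-1 * (rV_coord i p.1 - rV_coord i p.2)).
  apply: measurable_funM => //; apply: measurable_funB;
    apply: (measurableT_comp (measurable_rV_coord i)).
    exact: measurable_fst.
  exact: measurable_snd.
apply: measurable_funB => //; apply: measurable_sum => i.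
exact: measurable_funM (m i) (m i).
Qed.

(* The centre [z] of the cutoff is found by averaging over all centres. *)
Lemma exists_cutoff v (B : R) : smooth_on setT v -> (forall x, 0 <= v x) ->
  0 < B -> (\int[lebesgue_rV N]_x (v x)%:E = 1)%E ->
  (\int[lebesgue_rV N]_x (grad1 v x)%:E <= B%:E)%E ->
  exists z : 'rV[R]_N,
    (\int[lebesgue_rV N]_x ((grad1 v x + 2 * N%:R * B * v x) *
        \1_(cutoff_set z B^-1) x)%:E <
     (localization_const * B)%:E *
       \int[lebesgue_rV N]_x (v x * Num.max (cutoff z B^-1 x) 0)%:E)%E.
Proof.
move=> sv v0 B0 vI gI; apply: contrapT => /forallNP H.
pose r := B^-1; have r0 : 0 < r by rewrite invr_gt0.
have N0 : 0 < N%:R :> R by rewrite ltr0n.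
have mv : measurable_fun setT v.
  by apply: continuous_measurable_rV; exact: smooth_continuous.
have mg1 := measurable_grad1 sv.
have K0 := localization_const_gt0.
(* Inside the ball the [N] partial derivatives of the cutoff are bounded by [2 * B], so there [g]
   dominates the gradient of the product of [v] and the cutoff. *)
pose g (x : 'rV[R]_N) : R := grad1 v x + 2 * N%:R * B * v x.
have g0 x : 0 <= g x.
  apply: addr_ge0; first exact: grad1_ge0.
  by apply: mulr_ge0 => //; apply: mulr_ge0; [exact: mulr_ge0|exact: ltW].
have mg : measurable_fun setT g.
  by apply: measurable_funD => //; apply: measurable_funM.
pose W : set ('rV[R]_N * 'rV[R]_N) := [set p | 0 < cutoff p.2 r p.1].
have mW : measurable W.
  have h := @measurable_cutoff r.
  rewrite (_ : W = setT `&` (fun p : 'rV[R]_N * 'rV[R]_N =>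
      cutoff p.2 r p.1) @^-1` `]0, +oo[%classic).
    by apply: h.
  by rewrite setTI; apply/seteqP; split=> p; rewrite /W /= in_itv/= andbT.
pose f1 (p : 'rV[R]_N * 'rV[R]_N) : \bar R := (v p.1 * Num.max (cutoff p.2 r p.1) 0)%:E.
pose f2 (p : 'rV[R]_N * 'rV[R]_N) : \bar R := (g p.1 * \1_W p)%:E.
have mf1 : measurable_fun setT f1.
  apply/measurable_EFinP; apply: measurable_funM.
    by apply: (measurableT_comp mv); exact: measurable_fst.
  by apply: measurable_maxr => //; exact: measurable_cutoff.
have mf2 : measurable_fun setT f2.
  apply/measurable_EFinP; apply: measurable_funM.
    by apply: (measurableT_comp mg); exact: measurable_fst.
  exact: measurable_indic.
have f10 p : (0 <= f1 p)%E by rewrite lee_fin mulr_ge0// le_max lexx orbT.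
have f20 p : (0 <= f2 p)%E by rewrite lee_fin mulr_ge0// indicE.
(* A lower bound for the integral over [z] of the positive part of the cutoff at a fixed [x]: it is
   at least one half for [z] in a cube of side [r / (2 * N%:R)] at [x]. *)
pose kap := 2^-1 * (r / (2 * N%:R)) ^+ N.
have kap0 : 0 < kap by rewrite mulr_gt0// exprn_gt0// divr_gt0// mulr_gt0.
have low x : (kap%:E * (v x)%:E <= \int[lebesgue_rV N]_z f1 (x, z))%E.
  have s0 : 0 < r / (2 * N%:R) by rewrite divr_gt0// mulr_gt0.
  pose Q := cube x (r / (2 * N%:R)).
  have mQ : measurable Q by exact: measurable_cube.
  have mQE : measurable_fun setT (EFin \o (\1_Q : 'rV[R]_N -> R)).
    by apply/measurable_EFinP; exact: measurable_indic.
  have Q0 (z : 'rV[R]_N) : setT z -> (0 <= (EFin \o (\1_Q : 'rV[R]_N -> R)) z)%E.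
    by move=> _; rewrite /= lee_fin indicE.
  have v20 : 0 <= v x * 2^-1 by rewrite mulr_ge0.
  have <- : (\int[lebesgue_rV N]_z ((v x * 2^-1)%:E *
      (EFin \o (\1_Q : 'rV[R]_N -> R)) z) = kap%:E * (v x)%:E)%E.
    rewrite (ge0_integralZl_EFin (lebesgue_rV N) measurableT Q0 mQE v20).
    rewrite [X in (_ * X)%E]integral_indic// setIT.
    rewrite [X in (_ * X)%E](lebesgue_cube (n := N) _ (ltW s0)) -!EFinM.
    by congr EFin; rewrite /kap -mulrA mulrC.
  apply: ge0_le_integral => //.
  - by move=> z _; rewrite mule_ge0//= lee_fin// indicE.
  - exact: measurable_funeM mQE.
  - exact: (measurableT_comp mf1 (measurable_pair1 x)).
  - move=> z _; rewrite /f1 /= -EFinM lee_fin indicE.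
    have [zQ|] := boolP (z \in Q); last first.
      by rewrite mulr0 mulr_ge0// le_max lexx orbT.
    rewrite mulr1 ler_wpM2l// le_max; apply/orP; left.
    rewrite -[leLHS]mul1r; apply: cutoff_ge_half => // i.
    rewrite inE in zQ; have := zQ i; rewrite ler_norml.
    by move: (x ord0 i) (z ord0 i) (r / _) => a b c; lra.
have upp x : (\int[lebesgue_rV N]_z f2 (x, z) <= ((2 * r) ^+ N)%:E * (g x)%:E)%E.
  have mWx : measurable (xsection W x) by exact: measurable_xsection.
  have mWE : measurable_fun setT (EFin \o (\1_(xsection W x) : 'rV[R]_N -> R)).
    by apply/measurable_EFinP; exact: measurable_indic.
  have W0 (z : 'rV[R]_N) : setT z -> (0 <= (EFin \o (\1_(xsection W x) : 'rV[R]_N -> R)) z)%E.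
    by move=> _; rewrite /= lee_fin indicE.
  have -> : (\int[lebesgue_rV N]_z f2 (x, z) = (g x)%:E * lebesgue_rV N (xsection W x))%E.
    have -> : (lebesgue_rV N (xsection W x) =
        \int[lebesgue_rV N]_z (EFin \o (\1_(xsection W x) : 'rV[R]_N -> R)) z)%E.
      by rewrite [RHS]integral_indic// setIT.
    rewrite -[RHS](ge0_integralZl_EFin (lebesgue_rV N) measurableT W0 mWE (g0 x)).
    apply: eq_integral => z _; rewrite /f2 /= EFinM; congr (_ * _)%E.
    by rewrite !indicE mem_xsection.
  rewrite muleC; apply: lee_wpmul2r; first by rewrite lee_fin.
  have r20 : 0 <= 2 * r by rewrite mulr_ge0// ltW.
  rewrite -(@lebesgue_cube _ N (x - const_mx r) _ r20).
  apply: (@le_measure _ _ _ (lebesgue_rV N)); rewrite ?inE//.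
    exact: measurable_cube.
  move=> z; rewrite xsectionE => Wz i; have := cutoff_gt0_near r0 Wz i.
  by rewrite !mxE ltr_norml; move: (x ord0 i) (z ord0 i) => a b; lra.
have gI' : (\int[lebesgue_rV N]_x (g x)%:E <= (B * (1 + 2 * N%:R))%:E)%E.
  have NB0 : 0 <= 2 * N%:R * B by apply: mulr_ge0; [exact: mulr_ge0|exact: ltW].
  have mvE : measurable_fun setT (EFin \o v) by exact/measurable_EFinP.
  have vE0 (x : 'rV[R]_N) : setT x -> (0 <= (EFin \o v) x)%E by rewrite lee_fin.
  rewrite /g; under eq_integral do rewrite EFinD EFinM.
  rewrite ge0_integralD//; last 4 first.
  - by move=> x _; rewrite lee_fin grad1_ge0.
  - exact/measurable_EFinP.
  - by move=> x _; rewrite mule_ge0// lee_fin.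
  - exact: measurable_funeM mvE.
  rewrite [X in (_ + X)%E](ge0_integralZl_EFin (lebesgue_rV N) measurableT vE0 mvE NB0).
  rewrite [X in (_ + _ * X)%E]vI mule1 (_ : B * _ = B + 2 * N%:R * B).
    by rewrite EFinD leeD2r.
  by move: (N%:R : R) => a; ring.
have c0 : 0 <= localization_const * B by rewrite mulr_ge0// ltW.
have chain : ((localization_const * B)%:E * (kap%:E * 1) <=
    ((2 * r) ^+ N)%:E * (B * (1 + 2 * N%:R))%:E)%E.
  have i1 : (kap%:E * 1 <= \int[lebesgue_rV N]_z \int[lebesgue_rV N]_x f1 (x, z))%E.
    apply: (@le_trans _ _ (\int[lebesgue_rV N]_x \int[lebesgue_rV N]_z f1 (x, z))%E); last first.
      by rewrite le_eqVlt; apply/orP; left; apply/eqP; exact: fubini_tonelli.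
    have mvE : measurable_fun setT (EFin \o v) by exact/measurable_EFinP.
    have vE0 (x : 'rV[R]_N) : setT x -> (0 <= (EFin \o v) x)%E by rewrite lee_fin.
    rewrite -vI -(ge0_integralZl_EFin (lebesgue_rV N) measurableT vE0 mvE (ltW kap0)).
    apply: ge0_le_integral => //.
    - by move=> x _; rewrite mule_ge0// ?lee_fin// ltW.
    - exact: measurable_funeM mvE.
    - exact: measurable_fun_fubini_tonelli_F.
    - by move=> x _; exact: low.
  have mf1z : measurable_fun setT (fun z => \int[lebesgue_rV N]_x f1 (x, z))%E.
    exact: measurable_fun_fubini_tonelli_G.
  have f1z0 (z : 'rV[R]_N) : setT z -> (0 <= (fun z => \int[lebesgue_rV N]_x f1 (x, z)) z)%E.
    by move=> _; apply: integral_ge0.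
  apply: le_trans (lee_wpmul2l _ i1) _; first by rewrite lee_fin.
  rewrite -(ge0_integralZl_EFin (lebesgue_rV N) measurableT f1z0 mf1z c0).
  apply: (@le_trans _ _ (\int[lebesgue_rV N]_z \int[lebesgue_rV N]_x f2 (x, z))%E).
    apply: ge0_le_integral => //.
    - by move=> z _; rewrite mule_ge0// ?lee_fin//; exact: f1z0.
    - exact: measurable_funeM mf1z.
    - exact: measurable_fun_fubini_tonelli_G.
    - move=> z _; rewrite leNgt; apply/negP => lt; apply: (H z).
      apply: le_lt_trans lt; rewrite le_eqVlt; apply/orP; left; apply/eqP.
      by apply: eq_integral => x _; rewrite /f2 /= !indicE.
  apply: (@le_trans _ _ (\int[lebesgue_rV N]_x \int[lebesgue_rV N]_z f2 (x, z))%E).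
    by rewrite le_eqVlt; apply/orP; left; apply/eqP/esym; exact: fubini_tonelli.
  have mgE : measurable_fun setT (EFin \o g) by exact/measurable_EFinP.
  have gE0 (x : 'rV[R]_N) : setT x -> (0 <= (EFin \o g) x)%E by rewrite lee_fin.
  have r20 : 0 <= (2 * r) ^+ N by rewrite exprn_ge0// mulr_ge0// ltW.
  apply: le_trans (lee_wpmul2l _ gI'); last by rewrite lee_fin.
  rewrite -(ge0_integralZl_EFin (lebesgue_rV N) measurableT gE0 mgE r20).
  apply: ge0_le_integral => //.
  - by move=> x _; apply: integral_ge0.
  - exact: measurable_fun_fubini_tonelli_F.
  - exact: measurable_funeM mgE.
move: chain; rewrite mule1 -!EFinM lee_fin.
have -> : localization_const * B * kap = 2 * ((2 * r) ^+ N * (B * (1 + 2 * N%:R))).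
  rewrite /localization_const /kap.
  have -> : (2 * r) ^+ N = (4 * N%:R) ^+ N * (r / (2 * N%:R)) ^+ N.
    rewrite -exprMn; congr (_ ^+ N); field; rewrite gt_eqF//.
  by move: ((4 * N%:R) ^+ N) ((r / (2 * N%:R)) ^+ N) => a b; field.
have : 0 < (2 * r) ^+ N * (B * (1 + 2 * N%:R)).
  apply: mulr_gt0; first by rewrite exprn_gt0// mulr_gt0.
  by apply: mulr_gt0 => //; lra.
by move: ((2 * r) ^+ N * (B * (1 + 2 * N%:R))) => a; lra.
Qed.

End good_sets.

(** * Admissible sets of controlled volume *)

Section good_sets_existence.
Context {R : realType} {n : nat}.
Local Notation N := n.+1.
Implicit Types (v : 'rV[R]_N -> R) (Omega E : set 'rV[R]_N).

Lemma cutoff_set_box (z : 'rV[R]_N) (r : R) : 0 < r ->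
  forall x i, cutoff_set z r x ->
    - (\sum_j `|z ord0 j| + r) <= x ord0 i < \sum_j `|z ord0 j| + r.
Proof.
move=> r0 x i xU; have := cutoff_gt0_near r0 xU i.
have : `|z ord0 i| <= \sum_j `|z ord0 j| by rewrite (bigD1 i)//= lerDl sumr_ge0.
rewrite ler_norml ltr_norml.
by move: (\sum_j _) (x ord0 i) (z ord0 i) => a b c; lra.
Qed.

(** The volume bound is automatic in a ball of radius [1 / B], so any level is acceptable;
    [exists_cutoff] supplies precisely the strict inequality from which [good_level] starts. *)
Lemma small_good_set v Omega (L B : R) : smooth_on setT v -> (forall x, 0 <= v x) ->
  (forall x i, v x != 0 -> `|x ord0 i| <= L) -> (forall x, v x != 0 -> Omega x) ->
  0 < B -> (\int[lebesgue_rV N]_x (v x)%:E = 1)%E ->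
  (\int[lebesgue_rV N]_x (grad1 v x)%:E <= B%:E)%E ->
  exists E, [/\ admissible Omega E, (lebesgue_rV N E <= ((2 / B) ^+ N)%:E)%E &
    (hausdorff_measure n (boundary E) <=
      (@coarea_const R n * (@localization_const R n * B))%:E * lebesgue_rV N E)%E].
Proof.
move=> sv v0 vL vO B0 vI gI.
have [z zP] := exists_cutoff sv v0 B0 vI gI.
pose r := B^-1; have r0 : 0 < r by rewrite invr_gt0.
have [M M0 vM] := bounded_of_support sv vL.
have mv : measurable_fun setT v.
  by apply: continuous_measurable_rV; exact: smooth_continuous.
pose U := cutoff_set z r.
have oU : open U by exact: open_cutoff_set.
have mU : measurable U by exact: open_measurable_rV.
pose b := cutoff z r.
have sb : smooth_on setT b by exact: smooth_cutoff.
have mb : measurable_fun setT b.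
  by apply: continuous_measurable_rV; exact: smooth_continuous.
pose w x := v x * b x.
have sw : smooth_on setT w by exact: (smoothM sv sb).
pose g (x : 'rV[R]_N) := grad1 v x + 2 * N%:R * B * v x.
have g0 x : 0 <= g x.
  apply: addr_ge0; first exact: grad1_ge0.
  by apply: mulr_ge0 => //; apply: mulr_ge0; [exact: mulr_ge0|exact: ltW].
have mg : measurable_fun setT g.
  apply: measurable_funD; first exact: measurable_grad1.
  by apply: measurable_funM.
have gw x : U x -> grad1 w x <= g x.
  move=> Ux; rewrite /g /grad1.
  rewrite (_ : 2 * N%:R * B * v x = \sum_(i < N) (2 * B * v x)); last first.
    by rewrite sumr_const card_ord -[RHS]mulr_natl; move: (N%:R : R) => a; ring.
  rewrite -big_split/=; apply: ler_sum => i _.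
  rewrite (_ : pderiv i w x = v x * pderiv i b x + b x * pderiv i v x); last first.
    by rewrite /w (pderivM i sv sb).
  apply: le_trans (ler_normD _ _) _; rewrite [leLHS]addrC; apply: lerD.
    rewrite normrM ler_piMl// ger0_norm; last exact: ltW.
    exact: cutoff_le1.
  rewrite normrM ger0_norm// [leRHS]mulrC ler_wpM2l//.
  rewrite pderiv_cutoff normrN normrM ger0_norm; last first.
    by rewrite invrK mulr_ge0// ltW.
  rewrite invrK ler_piMr//; first by rewrite mulr_ge0// ltW.
  have := cutoff_gt0_near r0 Ux i; rewrite /r => h.
  rewrite normrM gtr0_norm//.
  by rewrite mulrC -ler_pdivlMr// mul1r ltW.
pose F2 := (\int[lebesgue_rV N]_x (g x * \1_U x)%:E)%E.
pose F1 := (\int[lebesgue_rV N]_x (v x * Num.max (b x) 0)%:E)%E.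
have {}zP : (F2 < (@localization_const R n * B)%:E * F1)%E by exact: zP.
have F10 : (0 <= F1)%E.
  by apply: integral_ge0 => x _; rewrite lee_fin mulr_ge0// le_max lexx orbT.
have F20 : (0 <= F2)%E.
  by apply: integral_ge0 => x _; rewrite lee_fin mulr_ge0// indicE.
have mF1 : measurable_fun setT (fun x => (v x * Num.max (b x) 0)%:E).
  apply/measurable_EFinP; apply: measurable_funM => //.
  exact: measurable_maxr.
have F11 : (F1 <= 1)%E.
  rewrite -vI; apply: ge0_le_integral => //.
  - by move=> x _; rewrite lee_fin mulr_ge0// le_max lexx orbT.
  - exact/measurable_EFinP.
  - move=> x _; rewrite lee_fin ler_piMr// ge_max ler01 andbT.
    exact: cutoff_le1.
have F1fin : F1 \is a fin_num by rewrite ge0_fin_numE//; apply: le_lt_trans F11 (ltry 1).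
have F2fin : F2 \is a fin_num.
  rewrite ge0_fin_numE//; apply: lt_trans zP _.
  by rewrite -(fineK F1fin) -EFinM ltry.
(* The truncation level [M + 1] exceeds [w] on [U], so truncating has no effect. *)
have T0 : 0 < M + 1 by rewrite addr_gt0.
have Q0 : 0 < @localization_const R n * B.
  by rewrite mulr_gt0// localization_const_gt0.
have L0 : 0 < \sum_j `|z ord0 j| + r by rewrite ltr_wpDl// sumr_ge0.
have [|||||E [t [adE _ EU _ HE]]] := @good_level R n w U Omega (\sum_j `|z ord0 j| + r)
    (M + 1) (@localization_const R n * B) (fine F2) (fine F1) sw oU
    (cutoff_set_box r0) L0 _ _ T0 Q0 _ _.
(* Positivity of the product on the closure forces [v x != 0], which gives membership in [Omega],
   and a nonzero cutoff, which excludes the sphere. *)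
- move=> x clx wx.
  have bx := closure_cutoff_set clx.
  have vx : v x != 0 by apply: contraTneq wx => vx; rewrite /w vx mul0r ltxx.
  split; last exact: vO.
  rewrite /U /cutoff_set /= lt_neqAle bx andbT.
  by apply: contraTneq wx => bx0; rewrite /w /b -bx0 mulr0 ltxx.
- by move=> x Ux; rewrite mulr_ge0// ltW.
- rewrite fineK//.
  apply: (@le_trans _ _ (\int[lebesgue_rV N]_(x in U) (g x)%:E)%E).
    apply: ge0_le_integral => //.
    + by move=> x _; rewrite lee_fin grad1_ge0.
    + by apply/measurable_EFinP; apply: measurable_funS (measurable_grad1 sw).
    + by apply/measurable_EFinP; apply: measurable_funS mg.
  apply: (@le_trans _ _ (\int[lebesgue_rV N]_(x in U) (g x * \1_U x)%:E)%E).
    rewrite le_eqVlt; apply/orP; left; apply/eqP; apply: eq_integral => x xU.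
    by rewrite indicE xU mulr1.
  apply: ge0_subset_integral => //.
    by apply/measurable_EFinP; apply: measurable_funM => //; exact: measurable_indic.
  by move=> x _; rewrite lee_fin mulr_ge0// indicE.
- rewrite fineK// /F1 integral_mkcond [leRHS]integral_mkcond.
  rewrite le_eqVlt; apply/orP; left; apply/eqP; apply: eq_integral => x _.
  rewrite !patchE in_setT; case: ifPn => xU.
    rewrite inE in xU; have bx : 0 < b x by exact: xU.
    rewrite (max_l (ltW bx)) min_l// /w.
    apply: (@le_trans _ _ (v x)); last by apply: (le_trans (vM x)); rewrite lerDl.
    by rewrite ler_piMr// cutoff_le1.
  have bx : b x <= 0.
    by rewrite leNgt; apply/negP => bx; move/negP: xU; apply; rewrite inE.
  by rewrite (max_r bx) mulr0.
- rewrite -lte_fin EFinM !fineK//.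
exists E; split => //.
apply: (@le_trans _ _ (lebesgue_rV N U)).
  apply: (@le_measure _ _ _ (lebesgue_rV N)); rewrite ?inE//.
  by apply: open_measurable_rV; have [] := adE.
exact: lebesgue_cutoff_set.
Qed.

(** [T] is the supremum of the levels whose superlevel set is still large. Above [T] the superlevel
    sets are small, so [poincare_small] bounds the mass of [v] there and the levels below [T] must
    carry the rest; a good level among these has a large superlevel set. *)
Lemma large_good_set v Omega (L B : R) : smooth_on setT v -> (forall x, 0 <= v x) ->
  0 < L -> (forall x i, v x != 0 -> `|x ord0 i| <= L) ->
  (forall x, v x != 0 -> Omega x) ->
  0 < B -> (\int[lebesgue_rV N]_x (v x)%:E = 1)%E ->
  (\int[lebesgue_rV N]_x (grad1 v x)%:E <= B%:E)%E ->
  exists E, [/\ admissible Omega E, (lebesgue_rV N E < +oo)%E,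
    (((8 * B)^-1 ^+ N / 2)%:E <= lebesgue_rV N E)%E &
    (hausdorff_measure n (boundary E) <=
      (@coarea_const R n * (3 * B))%:E * lebesgue_rV N E)%E].
Proof.
move=> sv v0 L0 vL vO B0 vI gI.
have [M M0 vM] := bounded_of_support sv vL.
have mv : measurable_fun setT v.
  by apply: continuous_measurable_rV; exact: smooth_continuous.
have N0 : 0 < N%:R :> R by rewrite ltr0n.
(* With this radius [cutoff_ge_half] puts the support of [v] inside [U]. Here [v] is not multiplied
   by the cutoff; the ball merely provides a bounded open domain. *)
pose r := 2 * N%:R * L; have r0 : 0 < r by rewrite !mulr_gt0.
pose U := cutoff_set (0 : 'rV[R]_N) r.
have oU : open U by exact: open_cutoff_set.
have mU : measurable U by exact: open_measurable_rV.
have vU x : v x != 0 -> U x.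
  move=> vx; rewrite /U /cutoff_set /=; apply: (@lt_le_trans _ _ (1 / 2)); first by lra.
  apply: cutoff_ge_half => // i; rewrite mxE subr0.
  rewrite (_ : r / _ = L); first exact: vL.
  by rewrite /r mulrC mulKf// gt_eqF// mulr_gt0.
have lU := lebesgue_cutoff_set (0 : 'rV[R]_N) r0.
have intU (h : 'rV[R]_N -> R) : (forall x, v x = 0 -> h x = 0) ->
    (\int[lebesgue_rV N]_(x in U) (h x)%:E = \int[lebesgue_rV N]_x (h x)%:E)%E.
  move=> h0; rewrite integral_mkcond; apply: eq_integral => x _.
  rewrite patchE; case: ifPn => // xU; rewrite h0//.
  apply/eqP/negPn/negP => /vU Ux; move/negP: xU; apply; by rewrite inE.
(* The side for which the bound [2 * s * B] of the Poincare inequality equals one quarter. *)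
pose s := (8 * B)^-1; have s0 : 0 < s by rewrite invr_gt0 mulr_gt0.
pose K := s ^+ N / 2; have K0 : 0 < K by rewrite divr_gt0// exprn_gt0.
pose m (t : R) := lebesgue_rV N [set x | t < v x].
have msup t : measurable [set x | t < v x].
  rewrite (_ : mkset _ = setT `&` v @^-1` `]t, +oo[%classic); first by apply: mv.
  by rewrite setTI; apply/seteqP; split=> x; rewrite /= in_itv/= andbT.
(* The element 0 is adjoined so that the supremum exists in any case; that [T] is positive follows
   afterwards from [head]. *)
pose S := [set t : R | t = 0 \/ (K%:E <= m t)%E].
have S0 : S 0 by left.
have SM t : S t -> t <= M.
  case=> [->|]; first exact: ltW.
  rewrite [_ <= M]leNgt => Kt; apply/negP => Mt.
  have t0 : [set x | t < v x] = set0.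
    apply/seteqP; split=> x //= tv; have := lt_trans Mt tv.
    by rewrite ltNge vM.
  by move: Kt; rewrite /m t0 measure0 lee_fin leNgt K0.
have hS : has_sup S by split; [exists 0|exists M => t /SM].
pose T := sup S.
have T00 : 0 <= T by exact: ub_le_sup hS.2 _ S0.
pose Vr := (2 * r) ^+ N; have Vr0 : 0 < Vr by rewrite exprn_gt0// mulr_gt0.
(* The superlevel set at [T] itself may still be large, so the Poincare inequality is applied at
   [T + e]. Over [U], of volume at most [Vr], the layer of height [e] has mass at most one
   quarter. *)
pose e := (4 * Vr)^-1; have e0 : 0 < e by rewrite invr_gt0 mulr_gt0.
have small : (m (T + e)%R <= (s ^+ N / 2)%:E)%E.
  rewrite leNgt; apply/negP => /ltW KT.
  have : T + e <= T by apply: (ub_le_sup hS.2); right.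
  by rewrite gerDl leNgt e0.
have tail := poincare_small sv L0 vL s0 small.
have tail4 : (\int[lebesgue_rV N]_x (Num.max (v x - (T + e)) 0)%:E <= (1 / 4)%:E)%E.
  apply: (le_trans tail); apply: (@le_trans _ _ ((2 * s)%:E * B%:E)%E).
    by apply: lee_wpmul2l => //; rewrite lee_fin mulr_ge0// ltW.
  by rewrite -EFinM lee_fin /s invfM; have := divff (lt0r_neq0 B0); nra.
have mmin : measurable_fun setT (fun x => (Num.min (v x) T)%:E).
  by apply/measurable_EFinP; exact: measurable_minr.
have mmax : measurable_fun setT (fun x => (Num.max (v x - (T + e)) 0)%:E).
  apply/measurable_EFinP; apply: measurable_maxr => //.
  exact: measurable_funB.
have head : ((1 / 2)%:E <= \int[lebesgue_rV N]_(x in U) (Num.min (v x) T)%:E)%E.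
  have h1 : (1 <= \int[lebesgue_rV N]_(x in U) (Num.min (v x) T)%:E + (1/4)%:E + (1/4)%:E)%E.
    rewrite -[leLHS]vI -intU//.
    apply: (@le_trans _ _ (\int[lebesgue_rV N]_(x in U)
       ((Num.min (v x) T)%:E + e%:E + (Num.max (v x - (T + e)) 0)%:E))%E).
      apply: ge0_le_integral => //.
      - by move=> x _; rewrite lee_fin.
      - by apply: measurable_funS (_ : measurable_fun setT _) => //; exact/measurable_EFinP.
      - apply: measurable_funS (_ : measurable_fun setT _) => //.
        by apply: emeasurable_funD => //; exact: emeasurable_funD.
      - move=> x _; rewrite -!EFinD lee_fin; have := v0 x.
        move: (v x) => a; rewrite /Num.min /Num.max; do 2 case: ifP; lra.
    have min0 x : 0 <= Num.min (v x) T by rewrite le_min v0.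
    have max0 x : 0 <= Num.max (v x - (T + e)) 0 by rewrite le_max lexx orbT.
    rewrite ge0_integralD//; last 4 first.
    - by move=> x _; rewrite adde_ge0// lee_fin// ltW.
    - by apply: measurable_funS (_ : measurable_fun setT _) => //; exact: emeasurable_funD.
    - by move=> x _; rewrite lee_fin.
    - exact: measurable_funS mmax.
    rewrite ge0_integralD//; last 3 first.
    - by move=> x _; rewrite lee_fin.
    - exact: measurable_funS mmin.
    - by move=> x _; rewrite lee_fin ltW.
    apply: leeD; first apply: leeD2l.
    - rewrite integral_cst//; apply: (@le_trans _ _ (e%:E * Vr%:E)%E).
        by apply: lee_wpmul2l; rewrite ?lee_fin// ltW.
      by rewrite -EFinM lee_fin /e invfM -mulrA mulVf ?gt_eqF//; lra.
    - apply: le_trans tail4; apply: ge0_subset_integral => //.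
      by move=> x _; rewrite lee_fin.
  move: h1; rewrite -addeA -EFinD.
  have : (0 <= \int[lebesgue_rV N]_(x in U) (Num.min (v x) T)%:E)%E.
    by apply: integral_ge0 => x _; rewrite lee_fin le_min v0.
  case: (integral _ _ _) => [i | |]; last by rewrite leeNy_eq.
    by rewrite -EFinD !lee_fin => i0; lra.
  by move=> _ _; exact: leey.
have T0 : 0 < T.
  rewrite lt_neqAle T00 andbT; apply/eqP => T0; move: head.
  rewrite integral0_eq; first by rewrite lee_fin; lra.
  by move=> x _; rewrite -T0 min_r.
have LU0 : 0 < \sum_j `|(0 : 'rV[R]_N) ord0 j| + r by rewrite ltr_wpDl// sumr_ge0.
(* With gradient bound [B] and mass [1 / 2], [good_level] needs a constant above [2 * B]. *)
have B30 : 0 < 3 * B by rewrite mulr_gt0.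
have [||||E [t [adE /andP[t0 tT] EU vE HE]]] := @good_level R n v U Omega _
    T (3 * B) B (1 / 2) sv oU (cutoff_set_box r0) LU0 _ _ T0 B30 _ head.
- by move=> x _ vx; split; [apply: vU|apply: vO]; rewrite gt_eqF.
- by [].
- apply: le_trans gI; apply: ge0_subset_integral => //.
    by apply/measurable_EFinP; exact: measurable_grad1.
  by move=> x _; rewrite lee_fin grad1_ge0.
- by lra.
have mE : measurable E by apply: open_measurable_rV; have [] := adE.
exists E; split => //.
  apply: (@le_lt_trans _ _ (lebesgue_rV N U)).
    by apply: (@le_measure _ _ _ (lebesgue_rV N)); rewrite ?inE.
  exact: le_lt_trans lU (ltry _).
(* Since [t] lies below the supremum, some [t'] in [S] exceeds it. As [t' > t > 0], it is not the
   adjoined 0, so its superlevel set is large, and it is contained in [E]. *)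
have [t' St' tt'] := sup_gt hS.1 tT.
have Kt' : (K%:E <= m t')%E.
  by case: St' => // t'0; move: tt'; rewrite t'0 ltNge (ltW t0).
apply: (le_trans Kt'); apply: (@le_measure _ _ _ (lebesgue_rV N)); rewrite ?inE//.
move=> x /= t'v; apply: vE; last exact: lt_trans tt' t'v.
by apply: vU; rewrite gt_eqF//; apply: lt_trans t'v; apply: lt_trans tt'.
Qed.

End good_sets_existence.

(** * The Cheeger inequality *)

Section cheeger.
Context {R : realType} {n : nat}.
Local Notation N := n.+1.
Implicit Types (u : 'rV[R]_N -> R) (Omega E : set 'rV[R]_N).

Lemma open_measure_gt0 E : open E -> E !=set0 -> (0 < lebesgue_rV N E)%E.
Proof.
move=> oE [x Ex]; have /nbhs_rVP[e e0 eE] := oE _ Ex.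
have e20 : 0 < e / 2 by rewrite divr_gt0.
apply: (@lt_le_trans _ _ (lebesgue_rV N (cube x (e / 2)))).
  by rewrite lebesgue_cube ?ltW// lte_fin exprn_gt0.
apply: (@le_measure _ _ _ (lebesgue_rV N)); rewrite ?inE.
- exact: measurable_cube.
- exact: open_measurable_rV.
move=> y xy; apply: eE => i; have := xy i; rewrite ltr_norml.
by move: (x ord0 i) (y ord0 i) => a b; lra.
Qed.

Lemma cheeger_le (q k m : R) Omega E : admissible Omega E ->
  (hausdorff_measure n (boundary E) <= k%:E * lebesgue_rV N E)%E ->
  lebesgue_rV N E = m%:E ->
  (cheeger_constant q Omega <= (k * m `^ (1 - q^-1))%:E)%E.
Proof.
move=> [E0 oE sE cE] HE mE.
have m0 : 0 < m by rewrite -lte_fin -mE; exact: open_measure_gt0.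
have mq0 : 0 < m `^ q^-1 by rewrite powR_gt0.
apply: (@le_trans _ _ (hausdorff_measure n (boundary E) / lebesgue_rV N E `^ q^-1)%E).
  by apply: ereal_inf_lbound; exists E.
rewrite mE poweR_EFin inver gt_eqF// lee_pdivrMr//.
apply: (le_trans HE); rewrite mE -!EFinM lee_fin -mulrA -powRD.
  by rewrite subrK powRr1// ltW.
by apply/implyP => _; rewrite gt_eqF.
Qed.

Lemma cheeger_le_of_gradient (q : R) : 0 < q ->
  exists2 C : R, 0 < C & forall (B L : R) (v : 'rV[R]_N -> R) Omega,
    smooth_on setT v -> (forall x, 0 <= v x) -> 0 < L ->
    (forall x i, v x != 0 -> `|x ord0 i| <= L) ->
    (forall x, v x != 0 -> Omega x) -> 0 < B ->
    (\int[lebesgue_rV N]_x (v x)%:E = 1)%E ->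
    (\int[lebesgue_rV N]_x (grad1 v x)%:E <= B%:E)%E ->
    (cheeger_constant q Omega <= (C * B `^ (N%:R / q - (N%:R - 1)))%:E)%E.
Proof.
move=> q0; have C0 := @coarea_const_gt0 R n.
pose b := 1 - q^-1.
(* The exponent of the theorem: for a volume of order [B^-N], the power of [B] is
   [1 - N (1 - 1/q) = N/q - (N - 1)]. *)
have expo (c B : R) : 0 < c -> 0 < B ->
    B * (c * (B ^+ N)^-1) `^ b = c `^ b * B `^ (N%:R / q - (N%:R - 1)).
  move=> c0 B0; rewrite powRM ?invr_ge0 ?exprn_ge0 ?ltW// mulrCA; congr (_ * _).
  rewrite -powR_invn ?ltW// -powRrM -[X in X * _]powRr1 ?ltW// -powRD.
    by congr (_ `^ _); rewrite /b; ring.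
  by apply/implyP => _; rewrite gt_eqF.
have [q1|q1] := leP 1 q.
  have b0 : 0 <= b by rewrite subr_ge0 invf_le1.
  exists (@coarea_const R n * @localization_const R n * (2 ^+ N) `^ b).
    by rewrite !mulr_gt0 ?powR_gt0 ?exprn_gt0 ?localization_const_gt0.
  move=> B L v Omega sv v0 L0 vL vO B0 vI gI.
  have [E [adE mE HE]] := small_good_set sv v0 vL vO B0 vI gI.
  have Efin : lebesgue_rV N E = (fine (lebesgue_rV N E))%:E.
    by rewrite fineK// ge0_fin_numE//; apply: le_lt_trans mE (ltry _).
  apply: (le_trans (cheeger_le q adE HE Efin)); rewrite lee_fin.
  move: mE; rewrite Efin lee_fin /= => mE.
  have K0 := @localization_const_gt0 R n.
  move: (@coarea_const R n) (@localization_const R n) C0 K0 {HE} => k1 k2 k10 k20.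
  rewrite -!mulrA ler_pM2l// ler_pM2l//.
  rewrite -expo// ?exprn_gt0// ler_pM2l//; apply: ge0_ler_powR => //.
  - by rewrite nnegrE fine_ge0.
  - by rewrite nnegrE mulr_ge0 ?invr_ge0 ?exprn_ge0// ltW.
  - by rewrite -expr_div_n.
have b0 : b <= 0 by rewrite subr_le0 invf_ge1// ltW.
exists (@coarea_const R n * 3 * (8^-1 ^+ N / 2) `^ b).
  by rewrite !mulr_gt0 ?powR_gt0// divr_gt0// exprn_gt0.
move=> B L v Omega sv v0 L0 vL vO B0 vI gI.
have [E [adE Eoo mE HE]] := large_good_set sv v0 L0 vL vO B0 vI gI.
have Efin : lebesgue_rV N E = (fine (lebesgue_rV N E))%:E.
  by rewrite fineK// ge0_fin_numE.
apply: (le_trans (cheeger_le q adE HE Efin)); rewrite lee_fin.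
move: mE; rewrite Efin lee_fin /= => mE.
have c0 : (0 : R) < 8^-1 ^+ N / 2 by rewrite divr_gt0// exprn_gt0.
have K0 : 0 < 8^-1 ^+ N / 2 * (B ^+ N)^-1 by rewrite mulr_gt0// invr_gt0 exprn_gt0.
have KE : (8 * B)^-1 ^+ N / 2 = 8^-1 ^+ N / 2 * (B ^+ N)^-1.
  by rewrite invfM exprMn [B^-1 ^+ _]exprVn mulrAC.
rewrite KE in mE.
move: (@coarea_const R n) C0 {HE} (8^-1 ^+ N / 2) c0 K0 mE {KE} => k1 k10 c c0 K0 mE.
rewrite -!mulrA ler_pM2l// ler_pM2l// -expo// ler_pM2l// -/b.
have m0 := lt_le_trans K0 mE.
(* The power with exponent [b <= 0] is decreasing, so the lower bound on the volume is used through
   the inverses, whose exponent [- b] is nonnegative. *)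
rewrite -[b]opprK ![_ `^ (- - _)]powRN lef_pV2 ?posrE ?powR_gt0//.
apply: ge0_ler_powR => //; first by rewrite oppr_ge0.
- by rewrite nnegrE ltW.
- by rewrite nnegrE ltW.
Qed.

(** A weighted AM-GM inequality replaces Cauchy-Schwarz, so the gradient of [u^2] is estimated
    pointwise. After integration both of its terms contribute [A] for each of the [N] partial
    derivatives, whence the gradient bound [2 * N%:R * A]. *)
Lemma cheeger_le_of_dirichlet (q : R) : 0 < q ->
  exists2 C : R, 0 < C & forall (A : R) u Omega,
    open Omega -> test_function Omega u -> 0 < A ->
    (\int[lebesgue_rV N]_(x in Omega) (`|u x| ^+ 2)%:E = 1)%E ->
    (\int[lebesgue_rV N]_(x in Omega) (enorm (grad u x) ^+ 2)%:E <= (A ^+ 2)%:E)%E ->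
    (cheeger_constant q Omega <= (C * A `^ (N%:R / q - (N%:R - 1)))%:E)%E.
Proof.
move=> q0; have [C C0 CP] := cheeger_le_of_gradient q0.
have N0 : 0 < N%:R :> R by rewrite ltr0n.
exists (C * (2 * N%:R) `^ (N%:R / q - (N%:R - 1))).
  by rewrite mulr_gt0// powR_gt0// mulr_gt0.
move=> A u Omega oO [su cu uO] A0 uI gI.
have mO : measurable Omega by exact: open_measurable_rV.
have [L L0 LP] := compact_sub_box cu.
pose v x := u x * u x.
have sv : smooth_on setT v by exact: (smoothM su su).
have vu x : v x != 0 -> closure [set x | u x != 0] x.
  by move=> vx; apply: subset_closure => /=; apply: contraNneq vx => ux; rewrite /v ux mul0r.
have ov (h : 'rV[R]_N -> R) : (forall x, u x = 0 -> h x = 0) ->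
    (\int[lebesgue_rV N]_x (h x)%:E = \int[lebesgue_rV N]_(x in Omega) (h x)%:E)%E.
  move=> h0; rewrite [RHS]integral_mkcond; apply: eq_integral => x _.
  rewrite patchE; case: ifPn => // xO; rewrite h0//.
  apply/eqP/negPn/negP => ux; move/negP: xO; apply; rewrite inE.
  by apply: uO; apply: subset_closure.
have gv x : grad1 v x <= N%:R * (A * `|u x| ^+ 2 + enorm (grad u x) ^+ 2 / A).
  rewrite [leRHS](_ : _ = \sum_(i < N) (A * `|u x| ^+ 2 + enorm (grad u x) ^+ 2 / A)).
    apply: ler_sum => i _; rewrite /v (pderivM i su su) /=.
    have := coord_le_enorm (grad u x) i; rewrite mxE => ce.
    rewrite -mulr2n normrMn normrM -[leLHS]mulr_natl; move: ce.
    move: (`|u x|) (`|pderiv i u x|) (enorm _) (normr_ge0 (u x))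
      (normr_ge0 (pderiv i u x)) => a p e a0 p0 pe.
    (* AM-GM: [2 a e <= A a^2 + e^2 / A] *)
    have h : 0 <= (A * a - e) ^+ 2 / A by rewrite divr_ge0 ?sqr_ge0// ltW.
    have E1 : (A * a - e) ^+ 2 / A = A * a ^+ 2 - 2 * (a * e) + e ^+ 2 / A.
      by field; rewrite gt_eqF.
    have h2 : a * p <= a * e by rewrite ler_wpM2l.
    by rewrite E1 in h; lra.
  by rewrite sumr_const card_ord mulr_natl.
have B0 : 0 < 2 * N%:R * A by rewrite !mulr_gt0.
have vI : (\int[lebesgue_rV N]_x (v x)%:E = 1)%E.
  rewrite ov; last by move=> x ux; rewrite /v ux mul0r.
  rewrite -uI; apply: eq_integral => x _.
  by rewrite real_normK ?num_real// expr2.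
have cenorm : measurable_fun setT (fun x => enorm (grad u x) ^+ 2).
  rewrite (_ : (fun _ => _) = fun x => \sum_(i < N) pderiv i u x * pderiv i u x).
    apply: measurable_sum => i; apply: measurable_funM;
      by apply: continuous_measurable_rV; apply: smooth_continuous; exact: smooth_pderiv.
  apply/funext => x; rewrite sqr_sqrtr; last by rewrite sumr_ge0// => i _; exact: sqr_ge0.
  by apply: eq_bigr => i _; rewrite mxE expr2.
have mu2 : measurable_fun setT (fun x => `|u x| ^+ 2).
  apply: measurable_funX; apply: measurableT_comp => //.
  by apply: continuous_measurable_rV; exact: smooth_continuous.
have bound : (\int[lebesgue_rV N]_x (grad1 v x)%:E <= (2 * N%:R * A)%:E)%E.
  rewrite ov; last first.
    move=> x ux; apply: big1 => i _.
    by rewrite /v (pderivM i su su) /= ux !mul0r addr0 normr0.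
  apply: (@le_trans _ _ (\int[lebesgue_rV N]_(x in Omega)
     ((N%:R * A)%:E * (`|u x| ^+ 2)%:E + (N%:R / A)%:E * (enorm (grad u x) ^+ 2)%:E))%E).
    apply: ge0_le_integral => //.
    - by move=> x _; rewrite lee_fin grad1_ge0.
    - by apply/measurable_EFinP; apply: measurable_funS (measurable_grad1 sv).
    - apply: emeasurable_funD; apply: measurable_funeM; apply/measurable_EFinP.
        exact: measurable_funS mu2.
      exact: measurable_funS cenorm.
    - move=> x _; rewrite -!EFinM -EFinD lee_fin; apply: (le_trans (gv x)).
      by rewrite mulrDr mulrA lerD2l mulrA mulrAC.
  have NA0 : 0 <= N%:R * A by rewrite mulr_ge0// ltW.
  have NA1 : 0 <= N%:R / A by rewrite divr_ge0// ltW.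
  have m1 : measurable_fun Omega (fun x => (`|u x| ^+ 2)%:E).
    by apply/measurable_EFinP; exact: measurable_funS mu2.
  have m2 : measurable_fun Omega (fun x => (enorm (grad u x) ^+ 2)%:E).
    by apply/measurable_EFinP; exact: measurable_funS cenorm.
  have p1 x : Omega x -> (0 <= (`|u x| ^+ 2)%:E)%E by rewrite lee_fin exprn_ge0.
  have p2 x : Omega x -> (0 <= (enorm (grad u x) ^+ 2)%:E)%E.
    by rewrite lee_fin exprn_ge0// enorm_ge0.
  rewrite ge0_integralD//; last 4 first.
  - by move=> x Ox; rewrite mule_ge0// p1.
  - exact: measurable_funeM m1.
  - by move=> x Ox; rewrite mule_ge0// p2.
  - exact: measurable_funeM m2.
  rewrite (ge0_integralZl_EFin (lebesgue_rV N) mO p1 m1 NA0).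
  rewrite [X in (_ + X)%E](ge0_integralZl_EFin (lebesgue_rV N) mO p2 m2 NA1).
  rewrite [X in (_ * X + _)%E]uI mule1.
  apply: (@le_trans _ _ ((N%:R * A)%:E + (N%:R / A)%:E * (A ^+ 2)%:E)%E).
    by rewrite leeD2l//; apply: lee_wpmul2l => //; rewrite lee_fin.
  rewrite -EFinM -EFinD lee_fin le_eqVlt; apply/orP; left; apply/eqP.
  by move: (N%:R : R) => a; field; rewrite gt_eqF.
have := CP _ L v Omega sv (fun x => sqr_ge0 (u x)) L0 (fun x i vx => LP x i (vu x vx))
  (fun x vx => uO x (vu x vx)) B0 vI bound.
have N20 : 0 <= 2 * N%:R :> R by exact: mulr_ge0.
by rewrite (powRM _ N20 (ltW A0)) mulrA.
Qed.

Lemma cheeger_constant_ge0 (q : R) Omega : (0 <= cheeger_constant q Omega)%E.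
Proof.
apply: le_ereal_inf_tmp => _ [E _ <-].
by rewrite mule_ge0 ?hausdorff_measure_ge0// inve_ge0 poweR_ge0.
Qed.

End cheeger.

Theorem mainTheorem3 (R : realType) (N : nat) (q : R)
    (hN : (2 <= N)%N) (hq0 : 0 < q) (hq1 : q < N%:R / (N%:R - 1)) :
  exists C : R, 0 < C /\
    forall Omega : set 'rV[R]_N, open Omega ->
      ((C^-1)%:E * cheeger_constant q Omega `^ (2 / (N%:R / q - (N%:R - 1)))
        <= poincare_constant Omega)%E.
Proof.
case: N hN hq1 => // n hN hq1.
have [C C0 CP] := @cheeger_le_of_dirichlet R n q hq0.
set al := n.+1%:R / q - (n.+1%:R - 1) in CP *.
have al0 : 0 < al.
  have n0 : (0 : R) < n.+1%:R - 1 by rewrite subr_gt0 ltr1n.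
  by rewrite subr_gt0 ltr_pdivlMr// mulrC -ltr_pdivlMr.
have C20 : 0 < C `^ (2 / al) by rewrite powR_gt0.
exists (C `^ (2 / al)); split => // Omega oO.
apply: le_ereal_inf_tmp => _ [u [tu uI] <-].
have D0 : (0 <= \int[lebesgue_rV n.+1]_(x in Omega) (enorm (grad u x) ^+ 2)%:E)%E.
  by apply: integral_ge0 => x _; rewrite lee_fin exprn_ge0// enorm_ge0.
rewrite lee_pdivrMl//.
case: (integral _ _ _) D0 (fun A => CP A u Omega oO tu) => [d | | //]; last first.
  by move=> _ _; rewrite gt0_muley ?leey// lte_fin.
rewrite lee_fin => d0 H; apply/lee_addgt0Pr => e e0.
(* [A] has to be positive even if the energy [d] were 0, so [d] is enlarged a little. Raising
   [C * A]^ al[to the power]2 / al[gives]C [^ (2 / al) * A ^+ 2], which explains the constant and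
   turns the enlargement into [e]. *)
have e'0 : 0 < e / C `^ (2 / al) by rewrite divr_gt0.
pose A := Num.sqrt (d + e / C `^ (2 / al)).
have A2 : A ^+ 2 = d + e / C `^ (2 / al) by rewrite sqr_sqrtr// addr_ge0// ltW.
have A0 : 0 < A by rewrite sqrtr_gt0 ltr_wpDl.
have hA : (cheeger_constant q Omega <= (C * A `^ al)%:E)%E.
  by apply: H => //; rewrite lee_fin A2 lerDl ltW.
apply: (@le_trans _ _ ((C * A `^ al)%:E `^ (2 / al))%E).
  apply: gt0_ler_poweR => //; rewrite ?in_itv/= ?leey ?andbT.
  - by rewrite divr_ge0// ltW.
  - exact: cheeger_constant_ge0.
  - by rewrite lee_fin mulr_ge0 ?powR_ge0// ltW.
rewrite poweR_EFin -EFinM -EFinD lee_fin (powRM _ (ltW C0) (powR_ge0 _ _)).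
rewrite -powRrM [al * _]mulrC divfK ?gt_eqF// (powR_mulrn _ (ltW A0)) A2.
by rewrite mulrDr [X in _ + X]mulrC divfK ?gt_eqF.
Qed.
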